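(* Let $c>0$ and suppose that there is a function $\epsilon:\mathbb{N}\to\mathbb{R}_{\ge 0}$ with $\epsilon(n)\to 0$ such that $\mathrm{pdeg}(\mathrm{OR}_n)\ge (\log n)^{c-\epsilon(n)}$ for all sufficiently large $n\in\mathbb{N}$. Then there is a function $\delta:\mathbb{N}\to\mathbb{R}_{\ge 0}$ with $\delta(n)\to 0$ such that every truly $n$-variate Boolean function $f:\{0,1\}^n\to\{0,1\}$ satisfies $\mathrm{pdeg}(f)\ge (\log n)^{c/(c+1)-\delta(n)}$.
   Context: For a Boolean function $f:\{0,1\}^n\to\{0,1\}$ and $\varepsilon\ge 0$, an $\varepsilon$-error probabilistic polynomial for $f$ is a random polynomial $\bm{P}$ over $\mathbb{R}[x_1,\ldots,x_n]$ (a probability distribution with finite support on real polynomials) such that for every $a\in\{0,1\}^n$, $\Pr_{\bm{P}}[\bm{P}(a)\neq f(a)]\le\varepsilon$. Its degree is at most $d$ if the distribution is supported on polynomials of degree at most $d$. The $\varepsilon$-error probabilistic degree $\mathrm{pdeg}_\varepsilon(f)$ is the least $d$ such that $f$ has an $\varepsilon$-error probabilistic polynomial of degree at most $d$, and $\mathrm{pdeg}(f):=\mathrm{pdeg}_{1/3}(f)$. $\mathrm{OR}_n$ is the OR function on $n$ variables. A Boolean function $f$ depends on its variable $x_i$ if there is an input $a$ such that flipping the $i$-th bit of $a$ changes the value of $f$; $f:\{0,1\}^n\to\{0,1\}$ is truly $n$-variate if it depends on all $n$ of its variables. Logarithms are to base 2. *)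

(* Defs.v *)
From HB Require Import structures.
From mathcomp Require Import all_boot all_order all_algebra finmap.
From mathcomp Require Import boolp classical_sets reals exp.
From mathcomp Require Import mpoly.

Set Implicit Arguments.
Unset Strict Implicit.
Unset Printing Implicit Defensive.

Import Order.TTheory GRing.Theory Num.Theory.
Local Open Scope ring_scope.

Definition cube (n : nat) := {ffun 'I_n -> bool}.

Definition boolfun (n : nat) := cube n -> bool.

Definition OR (n : nat) : boolfun n := fun a => [exists i, a i].
Arguments OR n a : clear implicits.

Definition flip (n : nat) (i : 'I_n) (a : cube n) : cube n :=
  [ffun j => if j == i then ~~ a j else a j].

Definition depends_on (n : nat) (f : boolfun n) (i : 'I_n) : Prop :=
  exists a : cube n, f (flip i a) <> f a.

Definition truly_nvariate (n : nat) (f : boolfun n) : Prop :=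
  forall i : 'I_n, depends_on f i.

Definition log2 (R : realType) (x : R) : R := ln x / ln 2.

Section ProbabilisticPolynomials.
Variables (R : realType) (n : nat).

(* The fsfun is the probability mass function; it is zero outside the finite
   set finsupp. *)
Record random_poly := RandomPoly {
  mass :> {fsfun {mpoly R[n]} -> R with 0};
  mass_ge0 : forall p, 0 <= mass p;
  mass_sum1 : \sum_(p <- finsupp mass) mass p = 1 }.

Definition prob (P : random_poly) (E : pred {mpoly R[n]}) : R :=
  \sum_(p <- finsupp P | E p) P p.

Definition evalb (p : {mpoly R[n]}) (a : cube n) : R :=
  p.@[fun i => (a i)%:R].

Definition is_prob_poly (eps : R) (f : boolfun n) (P : random_poly) : Prop :=
  forall a : cube n, prob P (fun p => evalb p a != (f a)%:R) <= eps.

(* msize p is 1 + deg p, and msize 0 = 0. *)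
Definition degree_le (P : random_poly) (d : nat) : Prop :=
  forall p, p \in finsupp P -> (msize p <= d.+1)%N.

Definition has_prob_poly (eps : R) (f : boolfun n) (d : nat) : Prop :=
  exists2 P : random_poly, is_prob_poly eps f P & degree_le P d.

(* The default value 0 of xget is never used when 0 <= eps: see pdeg_epsP. *)
Definition pdeg_eps (eps : R) (f : boolfun n) : nat :=
  xget 0%N (fun d => has_prob_poly eps f d /\
                     forall d', has_prob_poly eps f d' -> (d <= d')%N).

Definition pdeg (f : boolfun n) : nat := pdeg_eps 3^-1 f.

Definition point_fsfun (p : {mpoly R[n]}) : {fsfun {mpoly R[n]} -> R with 0} :=
  [fsfun q in [fset p]%fset => 1 | 0].

Lemma point_fsfunE p q : point_fsfun p q = (q == p)%:R.
Proof. by rewrite /point_fsfun fsfunE inE; case: (q == p). Qed.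

Lemma finsupp_point p : finsupp (point_fsfun p) = [fset p]%fset.
Proof.
apply/fsetP => q; rewrite mem_finsupp point_fsfunE inE.
by case: (q == p); rewrite ?oner_eq0 ?eqxx.
Qed.

Lemma point_ge0 p q : 0 <= point_fsfun p q.
Proof. by rewrite point_fsfunE ler0n. Qed.

Lemma point_sum1 p : \sum_(q <- finsupp (point_fsfun p)) point_fsfun p q = 1.
Proof. by rewrite finsupp_point big_seq_fset1 point_fsfunE eqxx. Qed.

Definition point_poly p : random_poly :=
  RandomPoly (@point_ge0 p) (point_sum1 p).

Definition interp (f : boolfun n) : {mpoly R[n]} :=
  \sum_(b : cube n) (f b)%:R%:MP * \prod_i (if b i then 'X_i else 1 - 'X_i).

Lemma evalb_interp f a : evalb (interp f) a = (f a)%:R.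
Proof.
rewrite /evalb /interp raddf_sum (bigD1 a) //= [X in _ + X]big1 => [|b ba].
  rewrite addr0 mevalM mevalC rmorph_prod big1 ?mulr1 // => i _.
  by case: ifP => ai /=; rewrite ?mevalB ?meval1 mevalXU ai ?subr0.
have /existsP [i bai] : [exists i, b i != a i].
  apply: contraR ba; rewrite negb_exists => /forallP h.
  by apply/eqP/ffunP => i; apply/eqP; move: (h i); rewrite negbK.
rewrite mevalM rmorph_prod (bigD1 i) //=; apply/eqP.
rewrite !mulf_eq0; apply/orP; right; apply/orP; left; apply/eqP; move: bai.
by case: (b i); case E: (a i) => // _; rewrite ?mevalB ?meval1 mevalXU E ?subrr.
Qed.

Lemma pdeg_epsP (eps : R) (f : boolfun n) : 0 <= eps ->
  has_prob_poly eps f (pdeg_eps eps f) /\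
  forall d', has_prob_poly eps f d' -> (pdeg_eps eps f <= d')%N.
Proof.
move=> eps0; rewrite /pdeg_eps.
have ex : exists d, `[< has_prob_poly eps f d >].
  exists (msize (interp f)); apply/asboolP; exists (point_poly (interp f)).
    move=> a; rewrite /prob /= finsupp_point big1_seq // => p /andP[+ pin].
    by move: pin; rewrite inE => /eqP ->; rewrite evalb_interp eqxx.
  by move=> p; rewrite /= finsupp_point inE => /eqP ->.
case: (ex_minnP ex) => d /asboolP hd dmin.
case: xgetP => [x -> //|/(_ d)]; case; split=> // d' hd'.
by apply: dmin; apply/asboolP.
Qed.

End ProbabilisticPolynomials.

(* Main.v *)
(** Put d = pdeg f and m = 2^(2^e), where 2^e is about (log n)^(1/(c+1)).

    If some input has m disjoint sensitive blocks, then identifying the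
    variables in each block turns f into G on m bits with G(0) <> G(e_j) for
    every unit vector e_j.  Restricting the input of OR_m to random subsets of
    log m different densities leaves exactly one 1 in one of them, so OR_m is an
    OR of O(log m) copies of G; a Razborov-style random polynomial for the outer
    OR, of degree O(log log m), gives pdeg(OR_m) = O(d (log log m)^2), whence
    d >= (log m)^(c-o(1)).

    Otherwise every input has a certificate of size at most m^2.  A random hash
    of the n variables into poly(m) colours is injective on the certificates of
    many sensitive pairs (a_j, j) simultaneously.  Leave one colour class free
    (variables z) and identify the variables inside every other class
    (variables u): for many j there is a point u_j with
    f(u_j, z) = z_j + const for all z.  For fixed z, polynomials of degree d
    in u form a space of dimension m^O(d), and such a space cannot contain
    approximations to all 0/1 strings longer than O(m^O(d)).  Hence
    log n = O(d log m). *)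

Require Import Defs.
From mathcomp Require Import all_boot all_order all_algebra finmap ring lra zify.
From mathcomp Require Import boolp classical_sets reals topology normedtype sequences exp.
From mathcomp Require mpoly.

Set Implicit Arguments.
Unset Strict Implicit.
Unset Printing Implicit Defensive.

Import Order.TTheory GRing.Theory Num.Theory.
Import numFieldNormedType.Exports.
Local Open Scope ring_scope.

(** * Functions on the cube given by polynomials of bounded degree *)

Section Degree.
Import -(notations) mpoly.
Local Notation msize p := (mpoly.msize p).
Variable R : realType.

(** Degree is attached to the function on the cube, so polynomials agreeing on 0/1 points are
    interchangeable. *)
Definition deg_le (n d : nat) (F : cube n -> R) : Prop :=
  exists2 p : mpoly n R, (msize p <= d.+1)%N & forall a, evalb p a = F a.

Lemma deg_le_ext n d (F G : cube n -> R) : F =1 G -> deg_le d F -> deg_le d G.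
Proof. by move=> FG [p sp Fp]; exists p => // a; rewrite Fp FG. Qed.

Lemma deg_leW n d d' (F : cube n -> R) :
  (d <= d')%N -> deg_le d F -> deg_le d' F.
Proof. by move=> dd' [p sp Fp]; exists p => //; apply: leq_trans sp _. Qed.

Lemma deg_le_cst n d (k : R) : deg_le d (fun _ : cube n => k).
Proof.
exists (mpolyC n k) => [|a]; last by rewrite /evalb mevalC.
by rewrite msizeC; case: (k == 0).
Qed.

Lemma deg_le_coord n (i : 'I_n) : deg_le 1 (fun a : cube n => (a i)%:R).
Proof. by exists (mpolyX R (mnm1 i)) => [|a]; [rewrite msizeX mdeg1|rewrite /evalb mevalXU]. Qed.

Lemma deg_leD n d (F G : cube n -> R) :
  deg_le d F -> deg_le d G -> deg_le d (fun a => F a + G a).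
Proof.
move=> [p sp Fp] [q sq Gq]; exists (p + q) => [|a].
  by rewrite (leq_trans (msizeD_le _ _)) // geq_max sp.
by rewrite /evalb mevalD -Fp -Gq.
Qed.

Lemma deg_leM n d e (F G : cube n -> R) :
  deg_le d F -> deg_le e G -> deg_le (d + e) (fun a => F a * G a).
Proof.
move=> [p sp Fp] [q sq Gq]; exists (p * q) => [|a]; last first.
  by rewrite /evalb mevalM -Fp -Gq.
have [->|p0] := eqVneq p 0; first by rewrite mul0r msize0.
have [->|q0] := eqVneq q 0; first by rewrite mulr0 msize0.
rewrite msizeM // -subn1 leq_subLR (leq_trans (leq_add sp sq)) //.
by rewrite addSn addnS add1n.
Qed.

Lemma deg_le_compl n d (F : cube n -> R) :
  deg_le d F -> deg_le d (fun a => 1 - F a).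
Proof.
move=> dF; apply: (@deg_le_ext _ _ (fun a => 1 + (fun=> -1 : R) a * F a)).
  by move=> a; rewrite mulN1r.
apply: deg_leD; first exact: deg_le_cst.
by apply: (@deg_leM _ 0 d); first exact: deg_le_cst.
Qed.

Lemma deg_le_sum n d (I : finType) (P : pred I) (F : I -> cube n -> R) :
  (forall i, P i -> deg_le d (F i)) -> deg_le d (fun a => \sum_(i | P i) F i a).
Proof.
move=> h; have /boolp.choice[p hp] : forall i, exists p : mpoly n R, P i ->
    (msize p <= d.+1)%N /\ forall a, evalb p a = F i a.
  move=> i; case: (boolP (P i)) => [/h[p sp Fp]|_]; first by exists p.
  by exists 0.
exists (\sum_(i | P i) p i) => [|a].
  apply: (leq_trans (msize_sum _ _ _)).
  by apply/bigmax_leqP => i /hp[].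
by rewrite /evalb raddf_sum; apply: eq_bigr => i /hp[_ <-].
Qed.

Lemma deg_le_prod n d (I : finType) (P : pred I) (F : I -> cube n -> R) :
  (forall i, P i -> deg_le d (F i)) ->
  deg_le (#|P| * d) (fun a => \prod_(i | P i) F i a).
Proof.
move=> h; rewrite -sum1_card big_distrl /=.
under eq_bigr do rewrite mul1n.
suff [p sp Fp] : exists2 p : mpoly n R,
   (msize p <= (\sum_(i <- [seq i <- index_enum I | P i]) d).+1)%N &
   forall a, evalb p a = \prod_(i <- [seq i <- index_enum I | P i]) F i a.
  by exists p => [|a]; rewrite -big_filter.
have: all P [seq i <- index_enum I | P i] by rewrite filter_all.
elim: [seq i <- _ | _] => [|i s IH] /=.
  rewrite big_nil => _; exists 1 => [|a]; first by rewrite msize1.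
  by rewrite big_nil /evalb meval1.
move=> /andP[Pi /IH[p sp Fp]].
have [|q sq Fq] := deg_leM (h i Pi) (G := evalb p) (e := \sum_(i <- s) d).
  by exists p.
exists q => [|a]; first by rewrite big_cons.
by rewrite Fq Fp big_cons.
Qed.

(** [None] stands for the factor 1, so a [d]-tuple of options encodes any multilinear monomial of
    degree at most [d]; there are [n.+1 ^ d] tuples. *)
Definition omono n (o : option 'I_n) (a : cube n) : R :=
  if o is Some i then (a i)%:R else 1.

Lemma meval_monom_cube n (m : multinom n) (a : cube n) :
  evalb (mpolyX R m) a =
  \prod_(i <- enum 'I_n | (0 < m i)%N) (a i)%:R.
Proof.
rewrite /evalb mevalX big_enum_cond /= [RHS]big_mkcond; apply: eq_bigr => i _.
by case: (m i) => [|k] //=; case: (a i); rewrite ?expr1n ?expr0n.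
Qed.

(** On 0/1 points exponents do not matter: list the support of the monomial, of size at most [d],
    and pad it with [None]. *)
Lemma mono_tuple n d (m : multinom n) : (mdeg m <= d)%N ->
  exists tau : {ffun 'I_d -> option 'I_n}, forall a : cube n,
    evalb (mpolyX R m) a = \prod_j omono (tau j) a.
Proof.
move=> md; pose s := [seq i <- enum 'I_n | (0 < m i)%N].
have ss : (size s <= d)%N.
  apply: leq_trans md; rewrite mdegE /s size_filter -sum1_count big_enum_cond.
  by rewrite /= big_mkcond; apply: leq_sum => i _; case: (m i).
exists [ffun j : 'I_d => nth None (map Some s) j] => a.
rewrite meval_monom_cube -big_filter -/s.
under [RHS]eq_bigr do rewrite ffunE.
rewrite -(big_map Some xpredT (fun o => omono o a)).
rewrite (big_nth None) size_map big_mkord.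
rewrite (big_ord_widen d (fun j => omono (nth None (map Some s) j) a) ss).
rewrite big_mkcond; apply: eq_bigr => j _; case: ltnP => // sj.
by rewrite nth_default // size_map.
Qed.

Lemma deg_le_span n d (F : cube n -> R) : deg_le d F ->
  exists c : {ffun 'I_d -> option 'I_n} -> R,
    forall a, F a = \sum_tau c tau * \prod_j omono (tau j) a.
Proof.
move=> [p sp Fp].
have /boolp.choice[t ht] : forall m : multinom n, exists tau : {ffun 'I_d -> option 'I_n},
   (mdeg m <= d)%N -> forall a : cube n,
    evalb (mpolyX R m) a = \prod_j omono (tau j) a.
  move=> m; case: (leqP (mdeg m) d) => [/mono_tuple[t ht]|_]; first by exists t.
  by exists [ffun=> None].
exists (fun tau => \sum_(m <- msupp p | t m == tau) mcoeff m p) => a.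
rewrite -Fp /evalb [in LHS](mpolyE p) raddf_sum /=.
under [RHS]eq_bigr do rewrite big_distrl /=.
rewrite (exchange_big_dep xpredT) //=.
rewrite !big_seq; apply: eq_bigr => m mp.
rewrite mevalZ -[meval _ _]/(evalb _ a) ht; last first.
  by rewrite -ltnS (leq_trans _ sp) // msize_mdeg_lt.
by rewrite (big_pred1 (t m)) // => tau; rewrite eq_sym.
Qed.

(** Each spanning product becomes a product of [d] factors of degree at most 1. *)
Lemma deg_le_comp n m d (F : cube n -> R) (g : cube m -> cube n) :
  deg_le d F -> (forall i, deg_le 1 (fun a => (g a i)%:R)) ->
  deg_le d (fun a => F (g a)).
Proof.
move=> /deg_le_span[c Fc] hg.
apply: (@deg_le_ext _ _ (fun a => \sum_tau c tau * \prod_j omono (tau j) (g a))).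
  by move=> a; rewrite Fc.
apply: deg_le_sum => tau _; apply: (@deg_leM _ 0 d).
  exact: deg_le_cst.
have /deg_leW : (#|@predT 'I_d| * 1 <= d)%N by rewrite muln1 card_ord.
apply; apply: deg_le_prod => j _.
by case: (tau j) => [i|] /=; [exact: hg|exact: deg_le_cst].
Qed.

End Degree.

(** * Finite probability spaces and error reduction *)

Section Distributions.
Variable R : realType.

Definition dist (T : finType) (w : T -> R) : Prop :=
  (forall x, 0 <= w x) /\ \sum_x w x = 1.

Definition Pr (T : finType) (w : T -> R) (E : pred T) : R := \sum_(x | E x) w x.

(** Seeds range over an arbitrary finite type, which makes products and powers of probability spaces
    easy to form; the next two lemmas give the equivalence with [has_prob_poly]. *)
Definition has_rpoly n (eps : R) (f : boolfun n) (d : nat) : Prop :=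
  exists (T : finType) (w : T -> R) (F : T -> cube n -> R),
    [/\ dist w, forall x, deg_le d (F x) &
        forall a, Pr w (fun x => F x a != (f a)%:R) <= eps].

Import -(notations) mpoly.
Local Notation msize p := (mpoly.msize p).
Local Open Scope fset_scope.

Lemma has_prob_poly_rpoly n (eps : R) (f : boolfun n) (d : nat) :
  has_prob_poly eps f d -> has_rpoly eps f d.
Proof.
case=> P Pf Pd; exists (finsupp P), (fun p => P (val p)), (fun p => evalb (val p)).
split.
- split=> [x|]; first exact: mass_ge0.
  by rewrite -(mass_sum1 P) big_seq_fsetE.
- by move=> p; exists (val p) => //; apply: Pd; exact: valP.
- move=> a; apply: le_trans (Pf a).
  by rewrite /prob big_mkcond big_seq_fsetE -big_mkcond.
Qed.

Lemma has_rpoly_prob_poly n (eps : R) (f : boolfun n) (d : nat) :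
  has_rpoly eps f d -> has_prob_poly eps f d.
Proof.
case=> T [w [F [[w0 w1] dF hF]]].
have /boolp.choice[p hp] : forall x, exists p : mpoly n R,
   (msize p <= d.+1)%N /\ forall a, evalb p a = F x a.
  by move=> x; case: (dF x) => p; exists p.
pose S : {fset mpoly n R} := [fset p x | x in T].
pose m := [fsfun q in S => \sum_(x | p x == q) w x | 0] :
  {fsfun mpoly n R -> R with 0}.
have pS x : p x \in S by apply/imfsetP; exists x.
have mE q : m q = \sum_(x | p x == q) w x.
  rewrite fsfunE; case: ifP => // qS; rewrite big1 // => x /eqP xq.
  by rewrite -xq pS in qS.
have sumE (E : pred (mpoly n R)) :
    \sum_(q <- finsupp m | E q) m q = \sum_(x | E (p x)) w x.
  rewrite big_mkcond /= (@big_fset_incl _ _ _ _ (finsupp m) S) /=; first last.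
  - by move=> q _; rewrite memNfinsupp => /eqP ->; rewrite if_same.
  - by apply/fsubsetP => q; rewrite mem_finsupp fsfunE; case: ifP; rewrite ?eqxx.
  rewrite -big_mkcond /=; under eq_bigr do rewrite mE.
  rewrite (exchange_big_dep (fun x => E (p x))) /=; last first.
    by move=> q x Eq /eqP ->.
  apply: eq_bigr => x Ex.
  rewrite big_mkcond (bigD1_seq (p x)) ?pS ?fset_uniq //= Ex eqxx.
  by rewrite big1 ?addr0 // => q qx; rewrite eq_sym (negbTE qx) andbF.
have m0 q : 0 <= m q by rewrite mE sumr_ge0.
have m1 : \sum_(q <- finsupp m) m q = 1 by rewrite (sumE xpredT).
exists (RandomPoly m0 m1) => [a|q qm].
  rewrite /prob /= sumE; apply: le_trans (hF a).
  by rewrite /Pr; under eq_bigl do rewrite (proj2 (hp _)).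
have : q \in S by apply: (fsubsetP (finsupp_sub _ _ _)) qm.
by case/imfsetP => x _ ->; case: (hp x).
Qed.

End Distributions.

Section DistributionTheory.
Variable R : realType.
Implicit Types T : finType.

Lemma Pr_le T (w : T -> R) (E E' : pred T) :
  dist w -> (forall x, E x -> E' x) -> Pr w E <= Pr w E'.
Proof.
move=> [w0 _] EE'; rewrite /Pr [leLHS]big_mkcond [leRHS]big_mkcond.
apply: ler_sum => x _; case: ifP => [/EE' ->//|_]; case: ifP => //.
Qed.

Lemma PrC T (w : T -> R) (E : pred T) : dist w -> Pr w (predC E) = 1 - Pr w E.
Proof. by case=> _ <-; rewrite [in RHS](bigID E) /= addrAC subrr add0r. Qed.

Lemma Pr_exists T (I : finType) (w : T -> R) (E : I -> pred T) :
  dist w -> Pr w (fun x => [exists i, E i x]) <= \sum_i Pr w (E i).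
Proof.
move=> [w0 _]; rewrite /Pr; under [leRHS]eq_bigr do rewrite big_mkcond.
rewrite exchange_big [leLHS]big_mkcond; apply: ler_sum => x _ /=.
case: ifP => [/existsP[i Ei]|_]; last by apply: sumr_ge0 => i _; case: ifP.
by rewrite (bigD1 i) //= Ei lerDl sumr_ge0 // => j _; case: ifP.
Qed.

Lemma Pr_or T (w : T -> R) (E E' : pred T) :
  dist w -> Pr w (fun x => E x || E' x) <= Pr w E + Pr w E'.
Proof.
move=> [w0 _]; rewrite /Pr !(big_mkcond _ w) /= -big_split /=.
apply: ler_sum => x _; move: (w0 x).
by case: (E x) (E' x) => [] [] /= h; rewrite ?addr0 ?add0r ?lerDl.
Qed.

Lemma Pr_disjoint T (I : finType) (P : pred I) (w : T -> R)
    (E : I -> pred T) (E' : pred T) : dist w ->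
  (forall i x, P i -> E i x -> E' x) ->
  (forall i j x, P i -> P j -> E i x -> E j x -> i = j) ->
  \sum_(i | P i) Pr w (E i) <= Pr w E'.
Proof.
move=> [w0 _] EE' dj; rewrite /Pr; under eq_bigr do rewrite big_mkcond.
rewrite exchange_big [leRHS]big_mkcond; apply: ler_sum => x _ /=.
case: (pickP (fun i => P i && E i x)) => [i /andP[Pi Ei]|no].
  rewrite (bigD1 i) //= Ei (EE' i) // big1 ?addr0 // => j /andP[Pj ji].
  by case: ifP => // Ej; rewrite (dj _ _ _ Pj Pi Ej Ei) eqxx in ji.
rewrite big1 => [|i Pi]; last by have := no i; rewrite Pi /= => ->.
by case: ifP.
Qed.

Definition unif T (_ : T) : R := #|T|%:R^-1.

Lemma dist_unif T : (0 < #|T|)%N -> dist (@unif T).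
Proof.
move=> T0; split=> [x|]; first by rewrite invr_ge0.
by rewrite /unif sumr_const -[LHS]mulr_natl mulfV // pnatr_eq0 -lt0n.
Qed.

Lemma Pr_unif T (E : pred T) : Pr (@unif T) E = #|E|%:R / #|T|%:R.
Proof. by rewrite /Pr sumr_const -[LHS]mulr_natl. Qed.

Definition dprod T1 T2 (w1 : T1 -> R) (w2 : T2 -> R) (x : T1 * T2) : R :=
  w1 x.1 * w2 x.2.

Lemma dist_dprod T1 T2 (w1 : T1 -> R) (w2 : T2 -> R) :
  dist w1 -> dist w2 -> dist (dprod w1 w2).
Proof.
move=> [p1 s1] [p2 s2]; split=> [x|]; first exact: mulr_ge0.
rewrite -(pair_bigA _ (fun x y => w1 x * w2 y)) /=.
by under eq_bigr do rewrite -mulr_sumr s2 mulr1.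
Qed.

Lemma Pr_dprod_le T1 T2 (w1 : T1 -> R) (w2 : T2 -> R) (E : pred (T1 * T2)) eps :
  dist w1 -> dist w2 -> (forall x, Pr w2 (fun y => E (x, y)) <= eps) ->
  Pr (dprod w1 w2) E <= eps.
Proof.
move=> [p1 s1] [p2 s2] h; rewrite /Pr big_mkcond.
rewrite (eq_bigr (fun x => (fun a b => if E (a, b) then w1 a * w2 b else 0)
  x.1 x.2)); last by case.
rewrite -(pair_bigA _ (fun a b => if E (a, b) then w1 a * w2 b else 0)) /=.
rewrite -[eps]mul1r -s1 mulr_suml; apply: ler_sum => x _.
rewrite -big_mkcond -mulr_sumr ler_wpM2l //; exact: h.
Qed.

Lemma Pr_dprod_swap T1 T2 (w1 : T1 -> R) (w2 : T2 -> R) (E : pred (T1 * T2)) :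
  Pr (dprod w1 w2) E = Pr (dprod w2 w1) (fun x => E (x.2, x.1)).
Proof.
rewrite /Pr (reindex (fun x : T2 * T1 => (x.2, x.1))) /=; last first.
  by exists (fun x => (x.2, x.1)) => -[].
by apply: eq_bigr => -[x y] _; rewrite /dprod /= mulrC.
Qed.

Definition dpow T (w : T -> R) (I : finType) (t : {ffun I -> T}) : R :=
  \prod_i w (t i).

Lemma Pr_dpow T (w : T -> R) (I : finType) (E : I -> pred T) :
  Pr (@dpow _ w I) (fun t => [forall i, E i (t i)]) = \prod_i Pr w (E i).
Proof.
rewrite /Pr; under [RHS]eq_bigr do rewrite big_mkcond.
rewrite bigA_distr_bigA /= [LHS]big_mkcond; apply: eq_bigr => t _.
case: ifP => [/forallP h|/forallPn[i ni]].
  by apply: eq_bigr => i _; rewrite h.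
by rewrite (bigD1 i) //= (negbTE ni) mul0r.
Qed.

Lemma dist_dpow T (w : T -> R) (I : finType) : dist w -> dist (@dpow _ w I).
Proof.
move=> [w0 w1]; split=> [t|]; first exact: prodr_ge0.
by rewrite /dpow -(bigA_distr_bigA (fun=> w)) /= w1 big1.
Qed.

(* Markov's inequality for the exponential moment [2 ^ #errors]. *)
Lemma Pr_half_bad T (w : T -> R) (E : pred T) r : dist w -> Pr w E <= 3^-1 ->
  Pr (@dpow _ w 'I_(2 * r)) (fun t => (r <= #|[pred j | E (t j)]|)%N)
    <= (8 / 9) ^+ r.
Proof.
move=> dw hE; have [w0 w1] := dw.
(* One trial has exponential moment [1 + Pr w E], at most 4/3; the [2 * r] independent trials
   multiply, and the event forces a value of at least [2 ^ r]. *)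
pose h x : R := w x * 2 ^+ E x.
have hs : \sum_x h x = 1 + Pr w E.
  rewrite -w1 /Pr [in X in _ + X]big_mkcond -big_split /=; apply: eq_bigr => x _.
  by rewrite /h; case: (E x); rewrite ?expr0 ?mulr1 ?addr0 // expr1 mulr_natr mulr2n.
have mom : \sum_(t : {ffun 'I_(2 * r) -> T}) \prod_j h (t j) <= (4 / 3) ^+ (2 * r).
  rewrite -(bigA_distr_bigA (fun _ => h)) /= prodr_const card_ord.
  apply: lerXn2r; rewrite ?nnegrE ?hs; try lra.
  by rewrite addr_ge0 // sumr_ge0.
have -> : (8 / 9 : R) ^+ r = (4 / 3) ^+ (2 * r) / 2 ^+ r.
  by rewrite exprM -expr_div_n; congr (_ ^+ _); field.
rewrite ler_pdivlMr ?exprn_gt0 //; apply: le_trans mom.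
rewrite /Pr mulr_suml [leLHS]big_mkcond; apply: ler_sum => t _ /=.
have h0 x : 0 <= h x by rewrite mulr_ge0 ?exprn_ge0.
case: ifP => [rE|_]; last exact: prodr_ge0.
rewrite /h big_split /= ler_wpM2l ?prodr_ge0 //.
rewrite prodrXr ler_eXn2l ?ltr1n //.
by rewrite (leq_trans rE) // -sum1_card big_mkcond.
Qed.

Lemma card_meet T (A G : pred T) :
  (#|T| < #|A| + #|G|)%N -> exists2 j, A j & G j.
Proof.
move=> h; have /card_gt0P[j] : (0 < #|[predI A & G]|)%N.
  rewrite lt0n; apply: contraTneq h => i0.
  by rewrite -cardUI i0 addn0 -leqNgt max_card.
by rewrite !inE => /andP[]; exists j.
Qed.

(* The values [y j] that differ from [b] may be arbitrary reals: every product
   in the sum (or, for [b = 1], in the complementary sum) has a zero factor. *)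
Lemma majority_correct r (y : 'I_(2 * r) -> R) (b : bool) :
  (#|[pred j | y j != b%:R]| < r)%N ->
  \sum_(S : {set 'I_(2 * r)} | (r <= #|S|)%N)
    \prod_j (if j \in S then y j else 1 - y j) = b%:R.
Proof.
move=> hr.
have all1 : \sum_(S : {set 'I_(2 * r)})
    \prod_j (if j \in S then y j else 1 - y j) = 1.
  rewrite -bigA_distr /= big1 // => j _; ring.
(* More than [r] of the [2 * r] indices carry the value [b], so every set of at least [r] indices
   contains one of them. *)
have meets (A : {pred 'I_(2 * r)}) : (r <= #|A|)%N -> exists2 j, j \in A & y j = b%:R.
  move=> rA; have [|j Aj] := @card_meet _ A [pred j | y j == b%:R].
    have := cardC [pred j | y j != b%:R]; rewrite card_ord.
    rewrite (@eq_card _ [predC [pred j | y j != b%:R]] [pred j | y j == b%:R]).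
      by move=> e; rewrite -[X in (X < _)%N]e ltn_add2r (leq_trans hr).
    by move=> j; rewrite !inE negbK.
  by move/eqP; exists j.
case: b {hr} meets => meets; last first.
  rewrite big1 // => S /meets[j jS yj].
  by rewrite (bigD1 j) //= jS yj mul0r.
rewrite -[RHS]all1 [in RHS](bigID (fun S : {set 'I_(2 * r)} => (r <= #|S|)%N)) /=.
rewrite [X in _ + X]big1 ?addr0 // => S; rewrite -ltnNge => Sr.
have [|j jS yj] := meets (~: S).
  rewrite -(leq_add2l #|S|) cardsC card_ord.
  by rewrite (@leq_trans (r + r)) ?leq_add2r ?(ltnW Sr) // addnn mul2n.
move: jS; rewrite !inE => /negbTE jS.
by rewrite (bigD1 j) //= jS yj subrr mul0r.
Qed.

(** Majority vote over [2 * r] independent copies, written as a polynomial in their outputs; it can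
    fail only if at least [r] copies err. *)
Lemma has_rpoly_amplify n (f : boolfun n) d r :
  has_rpoly (3^-1 : R) f d -> has_rpoly ((8 / 9 : R) ^+ r) f (2 * r * d).
Proof.
case=> T [w [F [dw dF hF]]].
exists {ffun 'I_(2 * r) -> T}, (@dpow _ w 'I_(2 * r)),
  (fun (t : {ffun 'I_(2 * r) -> T}) a => \sum_(S : {set 'I_(2 * r)} | (r <= #|S|)%N)
    \prod_j (if j \in S then F (t j) a else 1 - F (t j) a)); split.
- exact: dist_dpow.
- move=> t; apply: deg_le_sum => S _.
  have /deg_leW : (#|@predT 'I_(2 * r)| * d <= 2 * r * d)%N by rewrite card_ord.
  apply; apply: deg_le_prod => j _; case: (j \in S); first exact: dF.
  exact: deg_le_compl.
- move=> a; apply: le_trans (Pr_half_bad r dw (hF a)).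
  apply: Pr_le => [|t]; first exact: dist_dpow.
  by apply: contraR; rewrite -ltnNge => /majority_correct ->.
Qed.

Lemma bernoulli_ineq (p : R) k : 0 <= p -> p <= 1 -> 1 - k%:R * p <= (1 - p) ^+ k.
Proof.
move=> p0 p1; elim: k => [|k IH]; first by rewrite mul0r subr0 expr0.
rewrite exprS -natr1.
have : (1 - p) * (1 - k%:R * p) <= (1 - p) * (1 - p) ^+ k.
  by rewrite ler_wpM2l // subr_ge0.
have : 0 <= k%:R * p * p by rewrite !mulr_ge0.
nra.
Qed.

(** One uniform hash yields nested random subsets of all densities; the density is exactly [2 ^ -s]
    when [2 ^ s] divides [N]. *)
Definition sampled (I : finType) N (s : nat) (h : {ffun I -> 'I_N}) : pred I :=
  fun i => (h i < N %/ 2 ^ s)%N.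

(* Exactly one element of [x] falls in the random subset of density [2 ^ -s]. *)
Definition isolates (I : finType) N (x : pred I) (s : nat)
    (h : {ffun I -> 'I_N}) : bool :=
  #|[pred i | x i && sampled s h i]| == 1%N.

(** The events that a given [i] is the only sampled element of [x] are disjoint, each of probability
    [p (1 - p) ^ (W - 1)], where [p = 2 ^ -s] and [W] is the size of [x]. Bernoulli bounds their sum
    below by [W p (1 - W p)], at least 3/16 for [W p] between 1/4 and 1/2. *)
Lemma Pr_isolates (I : finType) l s (x : pred I) : (s <= l)%N ->
  (2 ^ s <= 4 * #|x|)%N -> (2 * #|x| <= 2 ^ s)%N ->
  3 / 16 <= Pr (@dpow _ (@unif 'I_(2 ^ l)) I) (isolates x s).
Proof.
move=> sl xs sx; set N := (2 ^ l)%N; set p : R := (2 ^+ s)^-1.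
have N0 : (0 < N)%N by rewrite expn_gt0.
have du : dist (@unif 'I_N) by apply: dist_unif; rewrite card_ord.
have s0 : 0 < (2 ^+ s : R) by rewrite exprn_gt0.
have p0 : 0 <= p by rewrite invr_ge0 ltW.
have p1 : p <= 1 by rewrite invf_le1 // exprn_ege1 // ler1n.
pose q := (N %/ 2 ^ s)%N.
have Prq : Pr (@unif 'I_N) (fun j => (j < q)%N) = p.
  rewrite Pr_unif card_ord.
  have -> : #|(fun j : 'I_N => (j < q)%N)| = q.
    rewrite -sum1_card (eq_bigl (fun j : 'I_N => (j < q)%N)) //.
    rewrite -(big_ord_widen N (fun=> 1%N)) ?leq_div //.
    by rewrite sum_nat_const card_ord muln1.
  rewrite /q /N -expnB // /p !natrX -[in X in _ / X](subnK sl) exprD invfM mulrA.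
  by rewrite divff ?mul1r // expf_neq0 // pnatr_eq0.
pose E0 i j : pred 'I_N := if j == i then fun k : 'I_N => (k < q)%N else
   if x j then fun k => ~~ (k < q)%N else fun=> true.
pose E i : pred {ffun I -> 'I_N} := fun h => [forall j, E0 i j (h j)].
have PE i : x i -> p * (1 - p) ^+ #|x|.-1 = Pr (@dpow _ (@unif 'I_N) I) (E i).
  move=> xi; rewrite (Pr_dpow _ (E0 i)) (bigD1 i) //= /E0 eqxx Prq; congr (_ * _).
  rewrite (eq_bigr (fun j => if x j then 1 - p else 1)); last first.
    move=> j /negbTE ->; case: (x j); first by rewrite PrC // Prq.
    by rewrite /Pr; case: du.
  rewrite -big_mkcondr prodr_const; congr (_ ^+ _).
  by rewrite (cardD1 i x) [i \in x]xi /=; apply: eq_card => j; rewrite !inE.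
apply: le_trans (_ : \sum_(i | x i) Pr (@dpow _ (@unif 'I_N) I) (E i) <= _); last first.
  apply: Pr_disjoint => [|i h xi /forallP Ei|i j h xi xj /forallP Ei /forallP Ej].
  - exact: dist_dpow.
  - apply/eqP; rewrite -(card1 i); apply: eq_card => j; rewrite !inE /sampled.
    have := Ei j; rewrite /E0; case: eqVneq => [-> -> |_]; first by rewrite xi.
    by case: (x j) => //= /negbTE.
  - have := Ei j; have := Ej j; rewrite /E0 eqxx eq_sym xj.
    by case: eqVneq => //= _ ->.
rewrite -(eq_bigr _ PE) sumr_const.
set W := #|x| in xs sx *.
have W0 : (0 < W)%N by have := expn_gt0 2 s; lia.

have Wp1 : 1 / 4 <= W%:R * p.
  have : (2 ^ s)%:R <= (4 * W)%:R :> R by rewrite ler_nat.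
  by rewrite ler_pdivlMr // natrX natrM; lra.
have Wp2 : W%:R * p <= 1 / 2.
  have : (2 * W)%:R <= (2 ^ s)%:R :> R by rewrite ler_nat.
  by rewrite ler_pdivrMr // natrX natrM; lra.
have hb := bernoulli_ineq W.-1 p0 p1.
have hb' : 1 - W%:R * p <= (1 - p) ^+ W.-1.
  apply: le_trans hb; rewrite lerD2l lerN2 ler_wpM2r // ler_nat; lia.
rewrite -[leRHS]mulr_natl mulrA.
apply: le_trans (_ : W%:R * p * (1 - W%:R * p) <= _); first by nra.
by rewrite ler_wpM2l // mulr_ge0.
Qed.

End DistributionTheory.

(** * Computing OR from sensitive blocks *)

Section OrReduction.
Variable R : realType.

Definition samples (I : finType) l := {ffun 'I_16 -> {ffun I -> 'I_(2 ^ l.+2)}}.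

Definition sampling (I : finType) l : samples I l -> R :=
  @dpow R _ (@dpow R _ (@unif R 'I_(2 ^ l.+2)) I) 'I_16.

Lemma dist_sampling (I : finType) l : dist (@sampling I l).
Proof. by do 2!apply: dist_dpow; apply: dist_unif; rewrite card_ord expn_gt0. Qed.

Lemma Pr_no_isolation (I : finType) l (x : pred I) :
  (0 < #|x|)%N -> (#|I| <= 2 ^ l)%N ->
  Pr (@sampling I l) (fun t =>
    ~~ [exists k, [exists s : 'I_l.+3, isolates x s (t k)]]) <= 16^-1.
Proof.
(* At this density the expected number of sampled elements of [x] lies between 1/4 and 1/2; sixteen
   independent failures then have probability at most [(13/16) ^ 16]. *)
move=> x0 Il; pose s := (trunc_log 2 #|x|).+2.
have /andP[lo hi] := trunc_log_bounds (isT : (1 < 2)%N) x0.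
have sl : (s <= l.+2)%N.
  rewrite !ltnS -(leq_exp2l _ _ (isT : (1 < 2)%N)).
  by rewrite (leq_trans lo) // (leq_trans (max_card _)).
have dd : dist (@dpow R _ (@unif R 'I_(2 ^ l.+2)) I).
  by apply: dist_dpow; apply: dist_unif; rewrite card_ord expn_gt0.
have iso : 3 / 16 <= Pr (@dpow R _ (@unif R 'I_(2 ^ l.+2)) I) (isolates x s).
  apply: Pr_isolates => //; rewrite /s !expnS; first lia.
  by move: hi; rewrite expnS; lia.
apply: le_trans (_ : Pr (@sampling I l) (fun t : samples I l =>
    [forall k, predC (isolates x s) (t k)]) <= _).
  apply: Pr_le => [|t]; first exact: dist_sampling.
  move/existsPn => h; apply/forallP => k /=.
  have /existsPn /(_ (Ordinal (sl : (s < l.+3)%N))) := h k.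
  by [].
rewrite /sampling (Pr_dpow _ (fun=> predC (isolates x s))) prodr_const card_ord PrC //.
have iso1 : Pr (@dpow R _ (@unif R 'I_(2 ^ l.+2)) I) (isolates x s) <= 1.
  by case: (dd) => _ <-; apply: Pr_le.
apply: le_trans (_ : (13 / 16) ^+ 16 <= _); last by lra.
by apply: lerXn2r; rewrite ?nnegrE; lra.
Qed.

(** Razborov's approximation of OR: a sample isolating a single 1 among the [y i] makes a factor
    vanish, and all-zero [y] gives 0. *)
Definition or_poly (I : finType) l (t : samples I l) (y : I -> R) : R :=
  1 - \prod_(p : 'I_l.+3 * 'I_16)
        (1 - \sum_(i | sampled p.1 (t p.2) i) y i).

Lemma Pr_or_poly (I : finType) l (y : pred I) : (#|I| <= 2 ^ l)%N ->
  Pr (@sampling I l)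
    (fun t => or_poly t (fun i => (y i)%:R) != [exists i, y i]%:R) <= 16^-1.
Proof.
move=> Il; case: (boolP [exists i, y i]) => [/existsP[i0 yi0]|/existsPn y0].
  apply: le_trans (Pr_no_isolation _ Il); last first.
    by apply/card_gt0P; exists i0; exact: yi0.
  apply: Pr_le => [|t]; first exact: dist_sampling.
  apply: contra => /existsP[k /existsP[s /eqP iso]].
  rewrite /or_poly (bigD1 (s, k)) //= (_ : \sum_(i | _) _ = 1) ?subrr ?mul0r ?subr0 //.
  rewrite [LHS]big_mkcond /= (eq_bigr (fun i => (y i && sampled s (t k) i)%:R)).
    transitivity (#|[pred i | y i && sampled s (t k) i]|%:R : R); last by rewrite iso.
    by rewrite -natr_sum -sum1_card [in RHS]big_mkcond.
  by move=> i _; case: (sampled _ _ _) (y i) => [] [].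
rewrite /Pr big1 ?invr_ge0 // => t; rewrite /or_poly big1 ?subrr ?eqxx // => p _.
by rewrite big1 ?subr0 // => i _; rewrite (negbTE (y0 i)).
Qed.

Lemma deg_le_or_poly n d (I : finType) l (t : samples I l) (F : I -> cube n -> R) :
  (forall i, deg_le d (F i)) ->
  deg_le (l.+3 * 16 * d) (fun a => or_poly t (fun i => F i a)).
Proof.
move=> dF; apply: deg_le_compl.
have /deg_leW : (#|@predT ('I_l.+3 * 'I_16)%type| * d <= l.+3 * 16 * d)%N.
  by rewrite card_prod !card_ord.
apply; apply: deg_le_prod => p _; apply: deg_le_compl.
by apply: deg_le_sum => i _.
Qed.

Lemma has_rpolyW n eps eps' (f : boolfun n) d d' :
  eps <= eps' -> (d <= d')%N ->
  has_rpoly (eps : R) f d -> has_rpoly eps' f d'.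
Proof.
move=> ee dd [T [w [F [dw dF hF]]]]; exists T, w, F; split=> // [x|a].
  exact: deg_leW dd (dF x).
exact: le_trans (hF a) ee.
Qed.

Lemma has_rpoly_comp n m eps (f : boolfun n) d (g : cube m -> cube n) :
  (forall i, deg_le 1 (fun a => (g a i)%:R : R)) ->
  has_rpoly (eps : R) f d -> has_rpoly eps (fun a => f (g a)) d.
Proof.
move=> dg [T [w [F [dw dF hF]]]]; exists T, w, (fun x a => F x (g a)).
by split=> // x; apply: deg_le_comp.
Qed.

Lemma has_rpoly_addb n eps (f : boolfun n) d b :
  has_rpoly (eps : R) f d -> has_rpoly eps (fun a => f a (+) b) d.
Proof.
case: b; last first.
  by under [fun a => f a (+) false]boolp.eq_fun do rewrite addbF.
case=> T [w [F [dw dF hF]]]; exists T, w, (fun x a => 1 - F x a); split=> //.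
  by move=> x; apply: deg_le_compl.
move=> a; apply: le_trans (hF a); apply: Pr_le => // x; apply: contra => /eqP ->.
by case: (f a); rewrite /= ?subrr ?subr0.
Qed.

(** The restrictions of [a] to the samples feed copies of [G], all approximated with one common
    seed; a sample isolating a 1 makes its copy true, whatever [G] is at inputs with several
    ones. *)
Lemma has_rpoly_or m (G : boolfun m) l l' d :
  (m <= 2 ^ l)%N -> (l.+3 * 16 <= 2 ^ l')%N ->
  G [ffun=> false] = false -> (forall i, G [ffun j => j == i]) ->
  has_rpoly ((16 * (l.+3 * 16)%:R)^-1 : R) G d ->
  has_rpoly (3^-1 : R) (OR m) (l'.+3 * 16 * d).
Proof.
move=> ml ll' G0 G1 [T [w [P [dw dP hP]]]].
pose J := ('I_l.+3 * 'I_16)%type.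
pose cap (t : samples 'I_m l) (p : J) (a : cube m) : cube m :=
  [ffun i => a i && sampled p.1 (t p.2) i].
pose W := dprod (dprod (@sampling 'I_m l) (@sampling J l')) w.
have dss : dist (dprod (@sampling 'I_m l) (@sampling J l')).
  by apply: dist_dprod; apply: dist_sampling.
exists ((samples 'I_m l * samples J l') * T)%type, W,
  (fun z a => or_poly z.1.2 (fun p => P z.2 (cap z.1.1 p a))); split.
- exact: dist_dprod.
- move=> [[t t'] x] /=; apply: deg_le_or_poly => p.
  apply: deg_le_comp => // i.
  apply: (@deg_le_ext _ _ _ (fun a => (a i)%:R * (fun=> (sampled p.1 (t p.2) i)%:R) a)).
    by move=> a; rewrite ffunE; case: (a i); case: sampled; rewrite ?mulr1 ?mulr0.
  by apply: (@deg_leM _ _ 1 0); [exact: deg_le_coord|exact: deg_le_cst].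
move=> a.
(* Three failures, each of probability at most 1/16: in [A] some copy of [G] is approximated
   wrongly, in [B] no sample isolates a 1 of a nonzero [a], in [C] the outer OR errs. *)
pose A (z : (samples 'I_m l * samples J l') * T) :=
  [exists p, P z.2 (cap z.1.1 p a) != (G (cap z.1.1 p a))%:R].
pose B (z : (samples 'I_m l * samples J l') * T) := [exists i, a i] &&
  ~~ [exists k, [exists s : 'I_l.+3, isolates a s (z.1.1 k)]].
pose C (z : (samples 'I_m l * samples J l') * T) :=
  or_poly z.1.2 (fun p => (G (cap z.1.1 p a))%:R) !=
  [exists p, G (cap z.1.1 p a)]%:R.
have dW : dist W by apply: dist_dprod.
have PA : Pr W A <= 16^-1.
  apply: Pr_dprod_le => // -[t t'] /=; apply: (le_trans (Pr_exists _ dw)).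
  apply: (@le_trans _ _ (\sum_(p : J) (16 * (l.+3 * 16)%:R)^-1)).
    by apply: ler_sum => p _; exact: (hP (cap t p a)).
  rewrite big_const card_prod !card_ord iter_addr_0 -[leLHS]mulr_natl invfM mulrCA mulfV ?mulr1 //.
  by rewrite pnatr_eq0.
have PB : Pr W B <= 16^-1.
  rewrite /W Pr_dprod_swap; apply: Pr_dprod_le => // x /=.
  rewrite Pr_dprod_swap; apply: Pr_dprod_le => [||t' /=]; try exact: dist_sampling.
  rewrite /B; case: (boolP [exists i, a i]) => [/existsP[i ai]|_]; last first.
    by rewrite /Pr big_pred0_eq invr_ge0.
  apply: Pr_no_isolation; last by rewrite card_ord.
  by apply/card_gt0P; exists i; exact: ai.
have PC : Pr W C <= 16^-1.
  rewrite /W Pr_dprod_swap; apply: Pr_dprod_le => // x /=.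
  apply: Pr_dprod_le => [||t /=]; try exact: dist_sampling.
  by apply: (@Pr_or_poly J l' (fun p => G (cap t p a))); rewrite card_prod !card_ord.
apply: (@le_trans _ _ (Pr W (fun z => (A z || B z) || C z))); last first.
  have := Pr_or (fun z => A z || B z) C dW; have := Pr_or A B dW.
  by move: PA PB PC; lra.
apply: Pr_le => // -[[t t'] x] /=; apply: contraR.
rewrite !negb_or => /andP[/andP[/existsPn nA nB] /negPn/eqP].
rewrite /= => nC.
have -> : (fun p => P x (cap t p a)) = (fun p => (G (cap t p a))%:R).
  by apply/boolp.funext => p; apply/eqP; have := nA p; rewrite negbK.
rewrite nC; apply/eqP; congr (_%:R); congr nat_of_bool.
rewrite /OR; case: (boolP [exists i, a i]) nB => [ex|/existsPn a0] /=.
  rewrite /B ex /= negbK => /existsP[k /existsP[s /eqP iso]].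
  apply/existsP; exists (s, k); rewrite /cap /=.
  have /card1P[i hi] : #|[pred i | a i && sampled s (t k) i]| == 1%N by apply/eqP.
  have -> : [ffun i => a i && sampled s (t k) i] = [ffun j => j == i]; last exact: G1.
  by apply/ffunP => j; rewrite !ffunE; have := hi j; rewrite !inE.
move=> _; apply/existsPn => p; rewrite (_ : cap t p a = [ffun=> false]) ?G0 //.
by apply/ffunP => i; rewrite !ffunE (negbTE (a0 i)).
Qed.

(** Six rounds halve the error because [(8/9) ^ 6 <= 1/2]; the target is the error that
    [has_rpoly_or] allows each copy when [l = 2 ^ e]. *)
Lemma amplify_small e : (8 / 9 : R) ^+ (6 * (e + 10)) <=
  (16 * ((2 ^ e).+3 * 16)%:R)^-1.
Proof.
rewrite exprM; apply: (@le_trans _ _ ((2^-1) ^+ (e + 10))).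
  by apply: lerXn2r; rewrite ?nnegrE; lra.
rewrite exprVn lef_pV2 ?posrE ?exprn_gt0 ?mulr_gt0 // -natrX -natrM ler_nat.
rewrite expnD; have : (0 < 2 ^ e)%N by rewrite expn_gt0.
by rewrite (_ : (2 ^ 10 = 1024)%N) //; lia.
Qed.

Definition flips n (S : {set 'I_n}) (a : cube n) : cube n :=
  [ffun i => a i (+) (i \in S)].

Lemma has_rpoly_or_blocks n (f : boolfun n) a d e
    (blk : 'I_(2 ^ (2 ^ e)) -> {set 'I_n}) :
  (forall i j x, x \in blk i -> x \in blk j -> i = j) ->
  (forall j, f (flips (blk j) a) != f a) ->
  has_rpoly (3^-1 : R) f d ->
  has_rpoly (3^-1 : R) (OR (2 ^ (2 ^ e))) (192 * (e + 10) ^ 2 * d).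
Proof.
move=> dj sens hf; set m := (2 ^ _)%N in blk dj sens *.
pose g (x : cube m) : cube n :=
  [ffun i => a i (+) [exists j, (i \in blk j) && x j]].
have g0 : g [ffun=> false] = a.
  apply/ffunP => i; rewrite ffunE (_ : [exists _, _] = false) ?addbF //.
  by apply/existsP => -[j]; rewrite ffunE andbF.
have g1 j : g [ffun k => k == j] = flips (blk j) a.
  apply/ffunP => i; rewrite !ffunE; congr (_ (+) _).
  apply/existsP/idP => [[k]|ij]; last by exists j; rewrite ij ffunE eqxx.
  by rewrite ffunE => /andP[ik /eqP <-].
(* Disjointness puts [i] in at most one block, so this coordinate is constant or is [a i] plus or
   minus a single variable. *)
have dg i : deg_le 1 (fun x => (g x i)%:R : R).
  case: (pickP (fun j => i \in blk j)) => [j ij|no].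
    apply: (@deg_le_ext _ _ _ (fun x => (a i)%:R +
       (fun=> if a i then -1 else 1) x * (x j)%:R)).
      move=> x; rewrite ffunE (_ : [exists _, _] = x j).
        by case: (a i) (x j) => [] [] /=; rewrite ?mulr1 ?mulr0 ?mulN1r ?subrr ?addr0 ?add0r.
      apply/existsP/idP => [[k /andP[ik]]|xj]; last by exists j; rewrite ij.
      by rewrite (dj _ _ _ ik ij).
    apply: deg_leD; first exact: deg_le_cst.
    by apply: (@deg_leM _ _ 0 1); [exact: deg_le_cst|exact: deg_le_coord].
  apply: (@deg_le_ext _ _ _ (fun=> (a i)%:R)); last exact: deg_le_cst.
  move=> x; rewrite ffunE (_ : [exists _, _] = false) ?addbF //.
  by apply/existsP => -[j]; rewrite no.
have hG := has_rpoly_addb (f a) (has_rpoly_comp dg hf).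
have hGa := has_rpolyW (amplify_small e) (leqnn _)
  (has_rpoly_amplify (6 * (e + 10)) hG).
(* The degree is [(e + 9) * 16] from the outer OR times [12 * (e + 10) * d] from the amplified
   copies. *)
apply: (has_rpolyW (lexx _) _ (has_rpoly_or (l' := e + 6) (leqnn _) _ _ _ hGa)).
- nia.
- by rewrite expnD; have : (0 < 2 ^ e)%N; [rewrite expn_gt0|lia].
- by rewrite g0 addbb.
- by move=> i; rewrite g1; case: (f _) (f a) (sens i) => [] [].
Qed.

End OrReduction.

Local Close Scope ring_scope.

(** * Functions with small certificates *)

Section Certificates.
Import boot.fintype boot.finset.
Variables (n : nat) (f : boolfun n).

Definition sensitive (a : cube n) (S : {set 'I_n}) : bool :=
  f (flips S a) != f a.

Definition certificate (a : cube n) (K : {set 'I_n}) : Prop :=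
  forall b : cube n, (forall i, i \in K -> b i = a i) -> f b = f a.

Definition block_family (a : cube n) (P : {set {set 'I_n}}) : bool :=
  trivIset P && [forall S in P, sensitive a S].

Lemma flips0 (a : cube n) : flips set0 a = a.
Proof. by apply/ffunP => i; rewrite ffunE inE addbF. Qed.

(** By minimality, undoing one element of [S] restores the value [f a], so at [flips S a] the
    singletons of [S] are disjoint sensitive blocks. *)
Lemma card_minimal_block m (a : cube n) (S : {set 'I_n}) :
  (forall b P, block_family b P -> (#|P| < m)%N) ->
  minset (sensitive a) S -> (#|S| < m)%N.
Proof.
move=> hm /minsetP[sS minS].
rewrite -(card_imset (mem S) (@set1_inj 'I_n)).
apply: (hm (flips S a)); apply/andP; split.
  apply/trivIsetP => _ _ /imsetP[i _ ->] /imsetP[j _ ->] ij.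
  rewrite -setI_eq0; apply/eqP/setP => k; rewrite !inE.
  by apply: contraNF ij => /andP[/eqP <- /eqP <-].
apply/forallP => B; apply/implyP => /imsetP[i iS ->]{B}.
have -> : sensitive (flips S a) [set i]%SET = (f (flips (S :\ i)%SET a) != f (flips S a)).
  congr (f _ != _); apply/ffunP => j; rewrite !ffunE !inE.
  by case: eqVneq => [->|_]; rewrite ?iS ?addbT ?addbF //= negbK.
have -> : f (flips (S :\ i) a) = f a.
  apply/eqP; apply: contraT => /minS /(_ (subsetDl _ _)) /setP /(_ i).
  by rewrite !inE eqxx iS.
by rewrite eq_sym.
Qed.

(** Nisan's argument: the union of a maximum family of disjoint minimal sensitive blocks is a
    certificate, made of fewer than [m] blocks of size below [m]. *)
Lemma certificate_exists m (a : cube n) :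
  (forall b P, block_family b P -> (#|P| < m)%N) ->
  exists2 K, certificate a K & (#|K| <= m ^ 2)%N.
Proof.
move=> hm.
pose fam P := block_family a P && [forall S in P, minset (sensitive a) S].
have fam0 : fam set0.
  apply/andP; split; [apply/andP; split|].
  - by apply/trivIsetP => A B; rewrite inE.
  - by apply/forallP => S; rewrite inE.
  - by apply/forallP => S; rewrite inE.
pose P := [arg max_(P > set0 | fam P) #|P|].
have [famP maxP] : fam P /\ forall Q, fam Q -> (#|Q| <= #|P|)%N.
  by rewrite /P; case: arg_maxnP => // Q; split.
have /andP[bP /forallP mP] := famP; have /andP[tP /forallP sP] := bP.
exists (cover P); last first.
  apply: (leq_trans (leq_card_cover P).1).
  apply: (@leq_trans (\sum_(A in P) m)%N).
    apply: leq_sum => S SP; apply: ltnW; apply: (card_minimal_block hm).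
    exact: implyP (mP S) SP.
  by rewrite sum_nat_const expnS expn1 leq_mul2r ltnW ?orbT // (hm a).
move=> b hb; apply/eqP; apply: contraT => fb.
(* If [f b] differed, the set where [b] departs from [a] would contain a minimal sensitive block
   disjoint from the family. *)
pose D := [set i | b i != a i]%SET.
have bD : flips D a = b.
  by apply/ffunP => i; rewrite ffunE inE; case: (a i) (b i) => [] [].
have [|A mA AD] := @minset_exists _ (sensitive a) D; first by rewrite /sensitive bD.
have /minsetP[sA _] := mA.
have AK B : B \in P -> [disjoint A & B].
  move=> BP; rewrite -setI_eq0; apply/eqP/setP => i; rewrite !inE.
  apply/negP => /andP[iA iB]; have := subsetP AD i iA.
  by rewrite inE hb ?eqxx //; apply/bigcupP; exists B.
have P0 : set0 \notin P.
  apply/negP => /(implyP (sP _)); rewrite /sensitive flips0 eqxx //.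
have [tAP nA] := trivIsetU1 AK tP P0.
suff /maxP : fam (A |: P)%SET by rewrite cardsU1 nA ltnn.
apply/andP; split; first (apply/andP; split => //).
  apply/forallP => S; apply/implyP; rewrite !inE => /orP[/eqP -> //|].
  exact/implyP/sP.
apply/forallP => S; apply/implyP; rewrite !inE => /orP[/eqP -> //|].
exact/implyP/mP.
Qed.

End Certificates.

Local Open Scope ring_scope.

(** * Low-degree functions cannot approximate all long 0/1 strings *)

Section Counting.
Import boot.fintype boot.finset.
Variable R : realType.

(** A maximal independent set of rows of the evaluation matrix has at most [#|K|] elements and spans
    all rows; points outside [A] get zero rows. *)
Lemma span_determined (I K : finType) (phi : K -> I -> R) (A : {set I}) :
  exists B : {set I}, [/\ B \subset A, (#|B| <= #|K|)%N &
    forall c : K -> R, (forall i, i \in B -> \sum_k c k * phi k i = 0) ->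
      forall i, i \in A -> \sum_k c k * phi k i = 0].
Proof.
pose X : 'M[R]_(#|I|, #|K|) := \matrix_(i, k)
  ((enum_val i \in A)%:R * phi (enum_val k) (enum_val i)).
pose g := maxrankfun X.
exists [set i in A | [exists j, enum_val (g j) == i]]%SET; split.
- by apply/subsetP => i; rewrite inE => /andP[].
- apply: leq_trans (rank_leq_col X).
  rewrite -[leqRHS]card_ord.
  apply: leq_trans (leq_imset_card (fun j => enum_val (g j)) _).
  apply/subset_leq_card/subsetP => i; rewrite inE => /andP[_].
  by move=> /existsP[j /eqP <-]; apply: imset_f.
move=> c hc i iA; pose C : 'cV[R]_#|K| := \col_k c (enum_val k).
have XC j : (X *m C) j 0 = (enum_val j \in A)%:R * \sum_k c k * phi k (enum_val j).
  rewrite mxE mulr_sumr [RHS](reindex (@enum_val K predT)) /=; last first.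
    exact/onW_bij/enum_val_bij.
  by apply: eq_bigr => k _; rewrite !mxE; ring.
suff XC0 : X *m C = 0.
  have := XC (enum_rank i); rewrite XC0 mxE enum_rankK iA mul1r; exact: esym.
have : rowsub g X *m C = 0.
  rewrite mul_rowsub_mx; apply/matrixP => j k; rewrite (ord1 k) mxE XC mxE.
  case: (boolP (_ \in A)) => [gA|]; last by rewrite mul0r.
  by rewrite hc ?mulr0 // inE gA /=; apply/existsP; exists j.
have /submxP[W WX] : (X <= rowsub g X)%MS by rewrite eq_maxrowsub.
by rewrite [in X in _ -> X]WX -mulmxA => ->; rewrite mulmx0.
Qed.

(** The base case is [2 * 5 ^ 6 = 31250 < 32768 = 2 ^ 15]. *)
Lemma leq_exp2_exp5 N : (2 ^ N * 5 ^ (6 * N) <= 2 ^ (15 * N))%N.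
Proof.
by case: N => // N; rewrite !expnM -expnMn leq_exp2r.
Qed.

Lemma leq_of_exp2_exp5 (N D : nat) :
  (2 ^ N * 5 ^ (6 * N) <= 2 ^ (6 * D) * 5 ^ (6 * N))%N -> (N <= 6 * D)%N.
Proof. by rewrite leq_pmul2r ?expn_gt0 // leq_exp2l. Qed.

(** Markov's inequality: the average disagreement is at most a twelfth of [#|I|], so at most half of
    the strings disagree on more than a sixth. *)
Lemma many_agreements (I : finType) (A : {ffun I -> bool} -> {set I}) :
  (12 * \sum_z #|~: A z| <= 2 ^ #|I| * #|I|)%N ->
  (2 ^ #|I| <= 2 * #|[pred z | 5 * #|I| <= 6 * #|A z|]|)%N.
Proof.
move=> h; set N := #|I| in h *.
have [N0|N0] := posnP N.
  rewrite N0 muln0; have -> : #|[pred z | (0 <= 6 * #|A z|)%N]| = #|{ffun I -> bool}|.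
    by apply: eq_card => z; rewrite !inE.
  by rewrite card_ffun card_bool -/N N0.
have cN z : (#|A z| + #|~: A z| = N)%N by rewrite cardsC.
have cF : #|{ffun I -> bool}| = (2 ^ N)%N by rewrite card_ffun card_bool.
pose good := [pred z | (5 * N <= 6 * #|A z|)%N]; rewrite -/good.
pose q := #|[predC good]|.
have hq : (#|good| + q = 2 ^ N)%N by rewrite /q cardC cF.
suff : (2 * q * N <= 2 ^ N * N)%N by rewrite leq_pmul2r //; lia.
have : (q * N <= 6 * \sum_z #|~: A z|)%N; last by lia.
rewrite big_distrr /= -sum_nat_const [leqLHS]big_mkcond /=.
apply: leq_sum => z _; rewrite !inE; rewrite -ltnNge; case: ifP => // hz.
by have := cN z; lia.
Qed.

(* [A z] is the set of points at which [F z] predicts [z].  The strings [z] with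
   a prescribed [A z = S] are determined by their values on a basis of the
   evaluations at [S] together with the complement of [S]; weighting [z] by
   [8 ^ #|A z|] makes the total [2 ^ D * 10 ^ N], too small for most [A z] to
   have size at least [5 N / 6]. *)
Lemma card_shattered_le (I : finType) M d (u : I -> cube M) (c : I -> bool)
    (F : {ffun I -> bool} -> cube M -> R) :
  (forall z, deg_le d (F z)) ->
  (12 * \sum_z #|[set i | F z (u i) != (z i (+) c i)%:R]%SET| <= 2 ^ #|I| * #|I|)%N ->
  (#|I| <= 6 * (M.+1 ^ d).+1)%N.
Proof.
move=> dF bad; set N := #|I| in bad *; set D := (M.+1 ^ d)%N.
pose A (z : {ffun I -> bool}) := [set i | F z (u i) == (z i (+) c i)%:R]%SET.
have AC z : ~: A z = [set i | F z (u i) != (z i (+) c i)%:R]%SET.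
  by apply/setP => i; rewrite !inE.
have {}bad : (12 * \sum_z #|~: A z| <= 2 ^ N * N)%N.
  by under eq_bigr do rewrite AC.
have /boolp.choice[k hk] : forall z, exists k : {ffun 'I_d -> option 'I_M} -> R,
    forall a, F z a = \sum_tau k tau * \prod_j omono R (tau j) a.
  by move=> z; apply: deg_le_span.
have cK : #|{ffun 'I_d -> option 'I_M}| = D.
  by rewrite card_ffun card_option !card_ord.
have fiber S : (#|[set z | A z == S]%SET| <= 2 ^ D * 2 ^ #|~: S|)%N.
  have [B [BS cB hB]] := span_determined
    (fun (tau : {ffun 'I_d -> option 'I_M}) i => \prod_j omono R (tau j) (u i)) S.
  rewrite cK in cB.
  pose r (z : {ffun I -> bool}) := [set i in B :|: ~: S | z i]%SET.
  rewrite -(@card_in_imset _ _ r); last first.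
    move=> z z'; rewrite !inE => /eqP zS /eqP z'S /setP rr.
    have agr i : i \in B :|: ~: S -> z i = z' i.
      by move=> iB; have := rr i; rewrite [in LHS]inE [in RHS]inE iB.
    apply/ffunP => i; case: (boolP (i \in S)) => iS; last first.
      by apply: agr; rewrite !inE iS orbT.
    have val w j : A w = S -> j \in S -> F w (u j) = (w j (+) c j)%:R.
      by move=> <-; rewrite inE => /eqP.
    (* This difference lies in the span and vanishes on [B], hence on all of [S]. *)
    have : F z (u i) - F z' (u i) = 0.
      rewrite !hk -sumrB; under eq_bigr do rewrite -mulrBl.
      apply: (hB (fun tau => k z tau - k z' tau)) => // j jB.
      under eq_bigr do rewrite mulrBl.
      have jS := subsetP BS j jB.
      rewrite sumrB -!hk !val // agr ?subrr // !inE jB //.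
    rewrite !val // => /eqP; rewrite subr_eq0 eqr_nat.
    by case: (z i) (z' i) (c i) => [] [] [].
  apply: leq_trans (_ : #|powerset (B :|: ~: S)| <= _)%N.
    apply/subset_leq_card/subsetP => T /imsetP[z _ ->].
    by rewrite inE; apply/subsetP => i; rewrite inE => /andP[].
  rewrite card_powerset -expnD leq_exp2l //.
  by rewrite (leq_trans (leq_card_setU _ _).1) ?leq_add2r.
have mom : (\sum_z 8 ^ #|A z| <= 2 ^ D * 10 ^ N)%N.
  rewrite (partition_big A xpredT) //=.
  (* Expand [(8 + 2) ^ N] over the subsets of [I]; the factors 2 count the free values off [S]. *)
  have -> : (10 ^ N = \sum_(S : {set I}) 8 ^ #|S| * 2 ^ #|~: S|)%N.
    rewrite -[10%N]/(8 + 2)%N -(prod_nat_const I) /= bigA_distr /=.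
    apply: eq_bigr => S _; rewrite -!prod_nat_const.
    rewrite [X in muln X _]big_mkcond [X in muln _ X]big_mkcond -big_split /=.
    apply: eq_bigr => i _; rewrite inE.
    by case: (i \in S).
  rewrite big_distrr; apply: leq_sum => S _ /=.
  rewrite (eq_bigr (fun=> 8 ^ #|S|)%N); last by move=> z /eqP ->.
  rewrite sum_nat_const mulnC mulnCA leq_mul2l; apply/orP; right.
  by apply: leq_trans (fiber S); rewrite cardsE.
have many := many_agreements bad.
(* [q] is [5 N / 6] rounded up; sixth powers below clear the denominator. *)
pose q := ((5 * N + 5) %/ 6)%N.
have hq : (5 * N <= 6 * q)%N by rewrite /q; lia.
have low : (2 ^ N * 8 ^ q <= 2 ^ D.+1 * 10 ^ N)%N.
  rewrite expnS -mulnA; apply: leq_trans (leq_mul (leqnn 2) mom).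
  apply: (leq_trans (leq_mul many (leqnn _))).
  rewrite -mulnA leq_mul2l /= -sum_nat_const [leqLHS]big_mkcond /=.
  apply: leq_sum => z _; case: ifP => //; rewrite inE => hz.
  rewrite leq_exp2l // -ltnS ltn_divLR // [leqRHS]mulSn -addnS [leqRHS]addnC.
  by rewrite leq_add2r [leqRHS]mulnC.
apply: leq_of_exp2_exp5.
have {}low : ((2 ^ N * 8 ^ q) ^ 6 <= (2 ^ D.+1 * 10 ^ N) ^ 6)%N.
  by rewrite leq_exp2r.
have e8 : (8 ^ (5 * N) <= (8 ^ q) ^ 6)%N.
  by rewrite -expnM leq_exp2l // [(q * 6)%N]mulnC.
have p1 : (0 < 2 ^ (6 * N))%N by rewrite expn_gt0.
rewrite -(leq_pmul2r p1).
apply: leq_trans (_ : (2 ^ N * 8 ^ q) ^ 6 <= _)%N; last first.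
  apply: (leq_trans low); rewrite !expnMn -!expnM [(D.+1 * 6)%N]mulnC [(N * 6)%N]mulnC.
  by rewrite -mulnA -expnMn.
rewrite expnMn -expnM [(N * 6)%N]mulnC [leqLHS]mulnC leq_mul2l; apply/orP; right.
apply: leq_trans e8; rewrite (_ : (8 = 2 ^ 3)%N) // -expnM mulnA.
exact: leq_exp2_exp5.
Qed.

End Counting.

(** * Random hashing of the variables into few colours *)

Section Hashing.
Import boot.fintype boot.finset.
Variable R : realType.

Lemma exists_ge_mean (T : finType) (w : T -> R) (X : T -> R) v :
  dist w -> v <= \sum_x w x * X x -> exists x, v <= X x.
Proof.
move=> [w0 w1] vX; apply/existsP; apply: contraT => /existsPn h.
have lt x : X x < v by rewrite ltNge h.
have : \sum_x w x * (v - X x) = 0.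
  apply/le_anti/andP; split; last first.
    by apply: sumr_ge0 => x _; rewrite mulr_ge0 // subr_ge0 ltW.
  under eq_bigr do rewrite mulrBr.
  by rewrite sumrB -mulr_suml w1 mul1r subr_le0.
move=> /psumr_eq0P h0; have : \sum_x w x = 0.
  apply: big1 => x _; have /eqP : w x * (v - X x) = 0.
    by apply: h0 => // y _; rewrite mulr_ge0 // subr_ge0 ltW.
  by rewrite mulf_eq0 subr_eq0 (gt_eqF (lt x)) orbF => /eqP.
by rewrite w1 => /eqP; rewrite oner_eq0.
Qed.

Lemma Pr_collision n M (l l' : 'I_n) : (0 < M)%N -> l != l' ->
  Pr (@dpow R _ (@unif R 'I_M) 'I_n) (fun s => s l == s l') <= M%:R^-1.
Proof.
move=> M0 ll'; have du : dist (@unif R 'I_M) by apply: dist_unif; rewrite card_ord.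
pose E (k : 'I_M) (i : 'I_n) : pred 'I_M :=
  if (i == l) || (i == l') then pred1 k else predT.
apply: le_trans (_ : Pr (@dpow R _ (@unif R 'I_M) 'I_n)
  (fun s => [exists k, [forall i, E k i (s i)]]) <= _).
  apply: Pr_le => [|s /eqP sl]; first exact: dist_dpow.
  apply/existsP; exists (s l); apply/forallP => i; rewrite /E.
  by case: eqVneq => [->|_] /=; [|case: eqVneq => [->|//]]; rewrite /= ?sl.
apply: (le_trans (Pr_exists (fun k (s : {ffun 'I_n -> 'I_M}) => [forall i, E k i (s i)])
  (dist_dpow 'I_n du))).
under eq_bigr do rewrite Pr_dpow.
have PE k : \prod_i Pr (@unif R 'I_M) (E k i) = M%:R^-1 * M%:R^-1.
  have P1 : Pr (@unif R 'I_M) (pred1 k) = M%:R^-1.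
    by rewrite Pr_unif card1 card_ord div1r.
  rewrite (bigD1 l) //= (bigD1 l') 1?eq_sym //= /E !eqxx orbT P1 big1 ?mulr1 //.
  move=> i /andP[/negbTE -> /negbTE ->] /=.
  by case: du.
under eq_bigr do rewrite PE.
rewrite big_const iter_addr_0 card_ord -[leLHS]mulr_natl mulrA mulfV ?mul1r //.
by rewrite pnatr_eq0 -lt0n.
Qed.

Definition inj_on n M (K : {set 'I_n}) (s : {ffun 'I_n -> 'I_M}) : bool :=
  [forall l in K, forall l' in K, (s l == s l') ==> (l == l')].

(** Union bound over at most [k ^ 2] pairs, each colliding with probability at most [1 / M]. *)
Lemma Pr_inj_on n M k (K : {set 'I_n}) : (0 < M)%N -> (#|K| <= k)%N ->
  (2 * k ^ 2 <= M)%N ->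
  2^-1 <= Pr (@dpow R _ (@unif R 'I_M) 'I_n) (inj_on K).
Proof.
move=> M0 Kk kM; have du : dist (@unif R 'I_M) by apply: dist_unif; rewrite card_ord.
have dd := dist_dpow 'I_n du.
have -> : Pr (@dpow R _ (@unif R 'I_M) 'I_n) (inj_on K) =
  1 - Pr (@dpow R _ (@unif R 'I_M) 'I_n) (predC (inj_on K)) by rewrite PrC // subKr.
suff h : Pr (@dpow R _ (@unif R 'I_M) 'I_n) (predC (inj_on K)) <= 2^-1.
  by move: h; lra.
pose E (p : 'I_n * 'I_n) (s : {ffun 'I_n -> 'I_M}) :=
  [&& p.1 \in K, p.2 \in K, p.1 != p.2 & s p.1 == s p.2].
apply: le_trans (_ : Pr (@dpow R _ (@unif R 'I_M) 'I_n)
  (fun s => [exists p, E p s]) <= _).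
  apply: Pr_le => // s /forallPn[l]; rewrite negb_imply => /andP[lK].
  move=> /forallPn[l']; rewrite !negb_imply => /and3P[lK' sl ll'].
  by apply/existsP; exists (l, l'); apply/and4P.
apply: (le_trans (Pr_exists E dd)).
apply: le_trans (_ : \sum_(p in setX K K) M%:R^-1 <= _).
  rewrite [leRHS]big_mkcond; apply: ler_sum => -[l l'] _; rewrite in_setX /E /=.
  case: (boolP (l \in K)) => _ /=; last by rewrite /Pr big_pred0_eq.
  case: (boolP (l' \in K)) => _ /=; last by rewrite /Pr big_pred0_eq.
  case: (boolP (l != l')) => ll' /=; last by rewrite /Pr big_pred0_eq invr_ge0.
  exact: Pr_collision.
rewrite sumr_const cardsX -[leLHS]mulr_natl ler_pdivrMr ?ltr0n //.
rewrite -(ler_pM2l (ltr0n R 2)) mulrA mulfV ?mul1r ?pnatr_eq0 // -natrM ler_nat.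
by apply: leq_trans kM; rewrite leq_mul2l /= expnS expn1 leq_mul.
Qed.

(** Two averagings: some hash is injective on at least half of the sets [K j], and some colour is
    taken by at least a [1 / M] fraction of the corresponding [j]. *)
Lemma exists_hash n M k (K : 'I_n -> {set 'I_n}) : (0 < M)%N ->
  (forall j, (#|K j| <= k)%N) -> (2 * k ^ 2 <= M)%N ->
  exists (s : {ffun 'I_n -> 'I_M}) (c : 'I_M),
    (n <= 2 * M * #|[set j | (s j == c) && inj_on (K j) s]|)%N.
Proof.
move=> M0 Kk kM; have du : dist (@unif R 'I_M) by apply: dist_unif; rewrite card_ord.
have dd := dist_dpow 'I_n du.
have [s hs] : exists s : {ffun 'I_n -> 'I_M},
    n%:R / 2 <= #|[set j | inj_on (K j) s]|%:R :> R.
  apply: (exists_ge_mean dd).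
  apply: le_trans (_ : \sum_(j < n) Pr (@dpow R _ (@unif R 'I_M) 'I_n) (inj_on (K j)) <= _).
    rewrite mulr_natl -[in leLHS](card_ord n) -sumr_const.
    by apply: ler_sum => j _; apply: Pr_inj_on.
  rewrite /Pr; under eq_bigr do rewrite big_mkcond.
  rewrite exchange_big /=; apply: ler_sum => s _.
  rewrite -big_mkcond sumr_const -[leLHS]mulr_natr ler_wpM2l ?(proj1 dd) //.
  by rewrite ler_nat cardsE.
have [c hc] : exists c : 'I_M, #|[set j | inj_on (K j) s]|%:R / M%:R <=
   #|[set j | (s j == c) && inj_on (K j) s]|%:R :> R.
  apply: (exists_ge_mean du); rewrite -mulr_sumr /unif card_ord mulrC ler_wpM2l //.
    by rewrite invr_ge0.
  rewrite -natr_sum ler_nat -sum1_card (partition_big (fun j => s j) xpredT) //=.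
  apply: leq_sum => c _; rewrite sum1_card; apply/subset_leq_card/subsetP => j.
  by rewrite unfold_in !inE andbC.
exists s, c; rewrite -(ler_nat R) !natrM.
have M0' : 0 < M%:R :> R by rewrite ltr0n.
by move: hc; rewrite ler_pdivrMr //; move: hs; lra.
Qed.

End Hashing.

(** * Bounding the number of variables by certificate size and degree *)

Section CertificateBound.
Import boot.fintype boot.finset.
Variable R : realType.

(* [s] is the hash and [c] the free colour; [X z u] fills the free class with [z]
   (and zeros outside [J]) and the class of each other colour [k] with [u k]. *)
Lemma certificate_bound n (f : boolfun n) C d :
  truly_nvariate f ->
  (forall a, exists2 K, certificate f a K & (#|K| <= C)%N) ->
  has_rpoly (3^-1 : R) f d ->
  (n <= 2 * (2 * (2 * C).+1 ^ 2) * (6 * ((2 * (2 * C).+1 ^ 2).+1 ^ (48 * d)).+1))%N.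
Proof.
move=> tf hC hf; set M := (2 * (2 * C).+1 ^ 2)%N.
have M0 : (0 < M)%N by rewrite muln_gt0 expn_gt0.
have /boolp.choice[a ha] : forall j, exists a : cube n, f (flip j a) <> f a by exact: tf.
have /boolp.choice[K0 hK0] : forall b, exists K, certificate f b K /\ (#|K| <= C)%N.
  by move=> b; case: (hC b) => K; exists K.
(* Certificates at both ends of a sensitive edge in direction [j], together with [j] itself. *)
pose K j := (j |: (K0 (a j) :|: K0 (flip j (a j))))%SET.
have cK j : (#|K j| <= (2 * C).+1)%N.
  rewrite cardsU1 -add1n leq_add ?leq_b1 //.
  apply: (leq_trans (leq_card_setU _ _).1).
  by rewrite mul2n -addnn leq_add ?(proj2 (hK0 _)).
have [s [c hn]] := exists_hash R M0 cK (leqnn M).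
set J := [set j | _]%SET in hn.
pose I := {j : 'I_n | j \in J}.
have cI : #|{: I}| = #|J| by rewrite card_sig; apply: eq_card => j; rewrite !inE.
apply: (leq_trans hn); rewrite leq_mul2l; apply/orP; right.
pose ext (z : {ffun I -> bool}) l := if insub l is Some j then z j else false.
pose X (z : {ffun I -> bool}) (u : cube M) : cube n :=
  [ffun l => if s l == c then ext z l else u (s l)].
(* For [j] in [J], each colour receives the value of [a j] at the unique point of [K j] with that
   colour, and false if there is none. *)
pose U j : cube M := [ffun k => [exists l, [&& l \in K j, s l == k & a j l]]].
pose cc (j : I) := a (val j) (val j) (+) f (a (val j)).
(* On [K j] the input agrees with [a j] or with its flip, according to [z j], so one of the two
   certificates fixes the value of [f]. *)
have fX z (j : I) : f (X z (U (val j))) = z j (+) cc j.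
  case: j => j jJ; have := jJ; rewrite inE => /andP[/eqP sj /forallP inj] /=.
  set j' := exist _ _ _; rewrite /cc /=.
  have injK l l' : l \in K j -> l' \in K j -> s l = s l' -> l = l'.
    move=> lK lK' ll'; have := inj l; rewrite lK => /forallP /(_ l').
    by rewrite lK' ll' eqxx => /eqP.
  have jK : j \in K j by rewrite !inE eqxx.
  have Xj : X z (U j) j = z j'.
    by rewrite ffunE sj eqxx /ext insubT.
  have Xl l : l \in K j -> l != j -> X z (U j) l = a j l.
    move=> lK lj; rewrite ffunE ifN; last first.
      by apply: contra lj; rewrite -sj => /eqP /injK ->.
    rewrite ffunE; apply/existsP/idP => [[l' /and3P[lK' /eqP sl al]]|al].
      by rewrite (injK _ _ lK lK' (esym sl)).
    by exists l; rewrite lK eqxx.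
  case: (eqVneq (z j') (a j j)) => [zj|zj].
    rewrite zj addbA addbb addFb; apply: (proj1 (hK0 (a j))) => i iK.
    case: (eqVneq i j) => [->|ij]; first by rewrite Xj.
    by apply: Xl => //; rewrite !inE iK orbT.
  have -> : f (X z (U j)) = f (flip j (a j)).
    apply: (proj1 (hK0 _)) => i iK; rewrite [RHS]ffunE.
    case: (eqVneq i j) => [->|ij].
      by rewrite Xj; move: zj; case: (z j') (a j j) => [] [].
    by apply: Xl => //; rewrite !inE iK !orbT.
  move: zj (ha j).
  by case: (z j') (a j j) (f (flip j (a j))) (f (a j)) => [] [] [] [].
(* Twenty-four rounds bring the error to at most [(1/2) ^ 4], below the 1/12 that the counting bound
   asks for, at degree [48 * d]. *)
have [T [w [P [dw dP hP]]]] := has_rpoly_amplify 24 hf.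
pose bad x z := #|[set i : I | P x (X z (U (val i))) != (z i (+) cc i)%:R]%SET|.
(* Averaging over the pairs of [z] and [i] fixes one seed for all [z]; signs are reversed because
   [exists_ge_mean] bounds from below. *)
have [x hx] : exists x, - (2 ^+ #|{: I}| * #|{: I}|%:R / 12) <= - (\sum_z bad x z)%:R :> R.
  apply: (exists_ge_mean dw).
  under eq_bigr do rewrite mulrN.
  rewrite sumrN lerN2.
  apply: (@le_trans _ _ (\sum_(z : {ffun I -> bool}) \sum_(i : I) Pr w
     (fun x => P x (X z (U (val i))) != (z i (+) cc i)%:R))).
    rewrite /Pr; under [leRHS]eq_bigr do under eq_bigr do rewrite big_mkcond.
    under [leRHS]eq_bigr do rewrite exchange_big.
    rewrite exchange_big /=; apply: ler_sum => x _.
    rewrite natr_sum mulr_sumr; apply: ler_sum => z _.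
    by rewrite -big_mkcond sumr_const -[leRHS]mulr_natr /bad cardsE.
  apply: (@le_trans _ _ (\sum_(z : {ffun I -> bool}) \sum_(i : I) 12^-1)).
    apply: ler_sum => z _; apply: ler_sum => i _; rewrite -fX.
    apply: (le_trans (hP _)); rewrite (exprM _ 6 4).
    have h6 : (8 / 9 : R) ^+ 6 <= 2^-1 by lra.
    apply: (@le_trans _ _ ((2^-1) ^+ 4)); last by lra.
    by apply: lerXn2r => //; rewrite nnegrE; lra.
  rewrite !big_const !iter_addr_0 card_ffun card_bool.
  by rewrite -[X in X *+ _]mulr_natl -[X in X <= _]mulr_natl natrX mulrA.
rewrite -cI; apply: (@card_shattered_le R I M (48 * d) (fun i => U (val i)) cc
  (fun z u => P x (X z u))).
  move=> z; apply: deg_le_comp => [|l]; first exact: dP.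
  case: (eqVneq (s l) c) => sl.
    apply: (@deg_le_ext _ _ _ (fun=> (ext z l)%:R)).
      by move=> u; rewrite /X ffunE sl eqxx.
    exact: deg_le_cst.
  apply: (@deg_le_ext _ _ _ (fun u => (u (s l))%:R)); last exact: deg_le_coord.
  by move=> u; rewrite /X ffunE (negbTE sl).
by move: hx; rewrite lerN2 ler_pdivlMr // -natrX -!natrM ler_nat mulnC.
Qed.

End CertificateBound.

(** * Many sensitive blocks or small certificates *)

Section Dichotomy.
Variable R : realType.

Lemma pdeg_rpoly n (f : boolfun n) : has_rpoly (3^-1 : R) f (pdeg R f).
Proof.
by apply: has_prob_poly_rpoly; case: (@pdeg_epsP R n 3^-1 f); rewrite // invr_ge0.
Qed.

Lemma pdeg_le n (f : boolfun n) d : has_rpoly (3^-1 : R) f d -> (pdeg R f <= d)%N.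
Proof.
move=> /has_rpoly_prob_poly h; have h3 : 0 <= 3^-1 :> R by rewrite invr_ge0.
by case: (pdeg_epsP f h3) => _; apply.
Qed.

(** A constant errs on at least one of two inputs with different values, so the two error
    probabilities add up to at least 1, more than 2/3. *)
Lemma pdeg_gt0 n (f : boolfun n) : truly_nvariate f -> (0 < n)%N ->
  (0 < pdeg R f)%N.
Proof.
move=> tf n0; rewrite lt0n; apply/eqP => d0.
have := pdeg_rpoly f; rewrite d0 => -[T [w [F [dw dF hF]]]].
have [a fa] := tf (Ordinal n0); set b := flip _ a in fa.
have Fab x : F x a = F x b.
  have [c Fc] := deg_le_span (dF x).
  by rewrite !Fc; apply: eq_bigr => t _; rewrite !big_ord0.
have : Pr w predT <= 3^-1 + 3^-1.
  apply: (le_trans _ (lerD (hF a) (hF b))); apply: (le_trans _ (Pr_or _ _ dw)).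
  apply: Pr_le => // x _ /=; rewrite Fab.
  case: (eqVneq (F x b) (f a)%:R) => //= ->; rewrite eqr_nat.
  by move: fa; case: (f a) (f b) => [] [].
by rewrite /Pr (proj2 dw); lra.
Qed.

(** Since [M.+1 <= m ^ 9], the large power contributes [9 * 48 = 432] per unit of [d]; the factor
    [24 * M] costs at most [m ^ (5 + 9)]. *)
Lemma certificate_numerics m d : (1 < m)%N ->
  (2 * (2 * (2 * m ^ 2).+1 ^ 2) *
     (6 * ((2 * (2 * m ^ 2).+1 ^ 2).+1 ^ (48 * d)).+1) <= m ^ (446 * d.+1))%N.
Proof.
move=> m1; set M := (2 * (2 * m ^ 2).+1 ^ 2)%N.
have m5 : (32 <= m ^ 5)%N by rewrite (@leq_exp2r 2 m 5).
have m40 : (0 < m ^ 4)%N by rewrite expn_gt0 ltnW.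
have M9 : (M.+1 <= m ^ 9)%N.
  rewrite (expnD m 5 4); apply: leq_trans (leq_mul m5 (leqnn _)).
  rewrite /M (expnM m 2 2); set q := (m ^ 2)%N in m40 *.
  have q0 : (0 < q)%N by rewrite expn_gt0 ltnW.
  by rewrite !expnS !expn0 !muln1; nia.
have X : (M.+1 ^ (48 * d) <= m ^ (432 * d))%N.
  rewrite (_ : (432 * d)%N = (9 * (48 * d))%N) ; last by lia.
  by rewrite [leqRHS]expnM; have [->|d0] := posnP d; [rewrite !muln0|rewrite leq_exp2r // muln_gt0].
have Y : ((M.+1 ^ (48 * d)).+1 <= 2 * m ^ (432 * d))%N.
  by have : (0 < m ^ (432 * d))%N; [rewrite expn_gt0 ltnW|lia].
have Z : (m ^ (14 + 432 * d) <= m ^ (446 * d.+1))%N by rewrite leq_exp2l //; lia.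
apply: leq_trans Z; rewrite expnD (expnD m 5 9).
have Z : (2 * M * (6 * (2 * m ^ (432 * d))) <= m ^ 5 * m ^ 9 * m ^ (432 * d))%N.
  rewrite (_ : (_ * (6 * _))%N = (24 * M * m ^ (432 * d))%N); last by lia.
  rewrite leq_mul2r; apply/orP; right; apply: leq_mul; last exact: ltnW.
  exact: leq_trans m5.
by apply: leq_trans Z; rewrite leq_mul2l leq_mul2l Y !orbT.
Qed.

Lemma pdeg_dichotomy n (f : boolfun n) e : truly_nvariate f ->
  (pdeg R (OR (2 ^ (2 ^ e))) <= 192 * (e + 10) ^ 2 * pdeg R f)%N \/
  (n <= (2 ^ (2 ^ e)) ^ (446 * (pdeg R f).+1))%N.
Proof.
move=> tf; set m := (2 ^ (2 ^ e))%N.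
have m1 : (1 < m)%N by rewrite /m -[1%N]/(2 ^ 0)%N ltn_exp2l // expn_gt0.
have [hm|/existsNP[b /existsNP[P /not_implyP[/andP[tP /forallP sP] mP]]]] :=
  pselect (forall b P, block_family f b P -> (#|P| < m)%N).
  right; apply: leq_trans (certificate_numerics (pdeg R f) m1).
  apply: (certificate_bound tf _ (pdeg_rpoly f)) => a.
  exact: certificate_exists hm.
left; apply: pdeg_le; move/negP: mP; rewrite -leqNgt => mP.
pose blk (j : 'I_m) : {set 'I_n} := enum_val (widen_ord mP j).
have blkP j : blk j \in P by apply: enum_valP.
apply: (@has_rpoly_or_blocks R n f b _ e blk _ _ (pdeg_rpoly f)).
- move=> i j x xi xj.
  have /finset.trivIsetP tP' := tP.
  have := tP' _ _ (blkP i) (blkP j).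
  case: (eqVneq (blk i) (blk j)) => [/enum_val_inj|_ /(_ isT)].
    by move=> /(congr1 val) /= ij _; apply: val_inj.
  by rewrite disjoint_subset => /fintype.subsetP/(_ x xi); rewrite inE xj.
- by move=> j; have := implyP (sP (blk j)) (blkP j).
Qed.

End Dichotomy.

Local Open Scope classical_set_scope.
Local Open Scope ring_scope.

(** * Asymptotics *)

Section Asymptotics.
Variable R : realType.

Lemma exists_nat_ge (x : R) : exists k : nat, x <= k%:R.
Proof.
exists (Num.bound `|x|); apply: (le_trans (ler_norm x)).
by apply/ltW/archi_boundP.
Qed.

Lemma ln2_gt0 : 0 < ln 2 :> R.
Proof. by rewrite ln_gt0 // ltr1n. Qed.

Lemma log2_exp k : log2 ((2 ^ k)%:R : R) = k%:R.
Proof.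
rewrite /log2 natrX lnXn // -[X in X / _]mulr_natl mulfK //.
by rewrite gt_eqF ?ln2_gt0.
Qed.

Lemma ler_log2 (m n : nat) : (0 < m)%N -> (m <= n)%N ->
  log2 (m%:R : R) <= log2 (n%:R : R).
Proof.
move=> m0 mn; rewrite /log2 ler_pM2r ?invr_gt0 ?ln2_gt0 // ler_ln ?posrE ?ltr0n ?ler_nat //.
exact: leq_trans mn.
Qed.

(** With [k = eta * ln 2 / 3] the right side is the cube of [expR (e * k)], at least [(e * k) ^ 3],
    and a cubic outgrows a quadratic. *)
Lemma polynomial_vs_power (eta : R) : 0 < eta ->
  exists e1 : nat, forall e : nat, (e1 <= e)%N ->
    (192 * (e + 10) ^ 2)%:R <= ((2 ^ e)%:R : R) `^ eta.
Proof.
move=> eta0; pose k := eta * ln 2 / 3.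
have k0 : 0 < k by rewrite divr_gt0 ?mulr_gt0 ?ln2_gt0.
have [e1 he1] := exists_nat_ge (768 / k ^+ 3).
exists (maxn e1 10) => e; rewrite geq_max => /andP[ee1 e10].
have -> : ((2 ^ e)%:R : R) `^ eta = expR (e%:R * k) ^+ 3.
  rewrite -expRM_natl /powR ifF; last by rewrite pnatr_eq0 expn_eq0.
  by rewrite natrX lnXn // -[ln 2 *+ _]mulr_natl; congr expR; rewrite /k; field.
apply: (@le_trans _ _ ((e%:R * k) ^+ 3)); last first.
  apply: lerXn2r; rewrite ?nnegrE ?expR_ge0 //; first by apply: mulr_ge0 => //; exact: ltW.
  by apply: le_trans (expR_ge1Dx _); rewrite lerDr.
have he : 768 <= e%:R * k ^+ 3.
  rewrite -ler_pdivrMr ?exprn_gt0 //; apply: (le_trans he1).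
  by rewrite ler_nat.
have h1 : (192 * (e + 10) ^ 2)%:R <= 768 * e%:R ^+ 2 :> R.
  by rewrite -natrX -natrM ler_nat !expnS expn0 !muln1; nia.
apply: (le_trans h1); rewrite (_ : (e%:R * k) ^+ 3 = e%:R * k ^+ 3 * e%:R ^+ 2).
  by rewrite ler_wpM2r ?exprn_ge0.
by ring.
Qed.

(** Here [log2] of the number of variables is [2 ^ e]; one [eta] pays for [eps], the other for the
    factor [192 * (e + 10) ^ 2]. *)
Lemma or_bound (c : R) (eps : nat -> R) (eta : R) :
  0 < eta -> eps n @[n --> \oo] --> 0 ->
  (\forall n \near \oo, log2 (n%:R : R) `^ (c - eps n) <= (pdeg R (OR n))%:R) ->
  exists e0 : nat, forall (e d : nat), (e0 <= e)%N ->
    (pdeg R (OR (2 ^ (2 ^ e))) <= 192 * (e + 10) ^ 2 * d)%N ->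
    ((2 ^ e)%:R : R) `^ (c - 2 * eta) <= d%:R.
Proof.
move=> eta0 /cvgr0_norm_lt/(_ _ eta0) [N1 _ h1] [N2 _ h2].
have [e1 he1] := polynomial_vs_power eta0.
exists (maxn e1 (maxn N1 N2)) => e d; rewrite !geq_max => /and3P[ee1 eN1 eN2] hd.
have em : (e <= 2 ^ (2 ^ e))%N.
  apply: ltnW; apply: (@ltn_trans (2 ^ e)); exact: ltn_expl.
have {}h1 : `|eps (2 ^ (2 ^ e))%N| < eta by apply: h1 => /=; apply: leq_trans em.
have {h2} := h2 (2 ^ (2 ^ e))%N (leq_trans eN2 em); rewrite log2_exp => h2.
set y : R := (2 ^ e)%:R in h2 *.
have y1 : 1 <= y by rewrite ler1n expn_gt0.
have y0 : 0 < y by apply: lt_le_trans y1.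
have {}he1 := he1 e ee1; rewrite -/y in he1.
have h3 : y `^ (c - eta) <= y `^ eta * d%:R.
  apply: (@le_trans _ _ (y `^ (c - eps (2 ^ (2 ^ e))%N))).
    by apply: ler_powR => //; rewrite lerB // ltW // (le_lt_trans (ler_norm _)).
  apply: (le_trans h2); apply: (@le_trans _ _ (192 * (e + 10) ^ 2 * d)%:R).
    by rewrite ler_nat.
  by rewrite natrM ler_wpM2r.
have -> : c - 2 * eta = (c - eta) - eta by ring.
rewrite powRB; last by rewrite (gt_eqF y0) implybT.
by rewrite ler_pdivrMr ?powR_gt0 // mulrC.
Qed.

Lemma powRK (x p : R) : 0 <= x -> p != 0 -> (x `^ p) `^ p^-1 = x.
Proof. by move=> x0 p0; rewrite -powRrM mulfV // powRr1. Qed.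

Lemma leq_446_892 d : (0 < d)%N -> (446 * d.+1 <= 892 * d)%N.
Proof. lia. Qed.

(** With [L = log2 n] and [2 ^ e] within a factor 2 of [y = L ^ (1 / (c + 1))], the two cases of the
    dichotomy balance: up to lower order terms they bound [d] below by [y ^ c] and by [L / y], both
    equal to [L ^ (c / (c + 1))]. *)
Lemma pdeg_lower (c : R) (eps : nat -> R) (eta : R) :
  0 < c -> 0 < eta -> eps n @[n --> \oo] --> 0 ->
  (\forall n \near \oo, log2 (n%:R : R) `^ (c - eps n) <= (pdeg R (OR n))%:R) ->
  exists N : nat, forall n (f : boolfun n), (N <= n)%N -> truly_nvariate f ->
    log2 (n%:R : R) `^ (c / (c + 1) - eta) <= (pdeg R f)%:R.
Proof.
move=> c0 eta0 heps hOR.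
(* The bound [eta / 4] keeps the loss in the exponent at most [eta / 2], leaving [eta / 2] for the
   constant [2 ^ c]; the bound [c / 2] keeps [c - 2 * h] nonnegative. *)
pose h := Num.min (eta / 4) (c / 2).
have h0 : 0 < h by rewrite lt_min !divr_gt0.
have h4 : h <= eta / 4 by rewrite ge_min lexx.
have hc : h <= c / 2 by rewrite ge_min lexx orbT.
have [e0 he0] := @or_bound c eps h h0 heps hOR.
have c1 : 0 < c + 1 by rewrite addr_gt0.
have c1' : c + 1 != 0 by rewrite gt_eqF.
have q0 : 0 <= c - 2 * h by lra.
have qc : c - 2 * h <= c by lra.
have q1 : c / (c + 1) - eta + eta / 2 <= (c + 1)^-1 * (c - 2 * h).
  have : 2 * h / (c + 1) <= 2 * h.
    by rewrite ler_pdivrMr // ler_peMr ?mulr_ge0 ?(ltW h0) // lerDr ltW.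
  rewrite (_ : (c + 1)^-1 * _ = c / (c + 1) - 2 * h / (c + 1)); last by field.
  lra.
(* From [log2 n >= A] the three lower order terms are absorbed. *)
have [K hK] := exists_nat_ge (Num.max 1 (Num.max ((2 ^ e0)%:R `^ (c + 1))
  (Num.max (892 `^ eta^-1) ((2 `^ c) `^ (eta / 2)^-1)))).
exists (2 ^ K)%N => n f Kn tf.
have n0 : (0 < n)%N by apply: leq_trans Kn; rewrite expn_gt0.
set L := log2 _; have LK : K%:R <= L by rewrite -log2_exp ler_log2 // expn_gt0.
have := le_trans hK LK; rewrite !ge_max => /and4P[L1 Le L892 L2c].
have L0 : 0 < L by apply: lt_le_trans L1.
set d := pdeg R f; have d0 : (0 < d)%N by apply: pdeg_gt0.
pose y := L `^ (c + 1)^-1.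
have y0 : 0 < y by apply: powR_gt0.
have ye : (2 ^ e0)%:R <= y.
  rewrite -[leLHS](@powRK _ (c + 1)) //.
  apply: ge0_ler_powR; rewrite ?nnegrE ?powR_ge0 ?invr_ge0 ?(ltW c1) ?(ltW L0) //.
have y1 : 1 <= y by apply: le_trans ye; rewrite ler1n expn_gt0.
have /andP[ty1 ty2] := truncn_itv (ltW y0).
have t0 : (0 < Num.truncn y)%N by rewrite truncn_ge_nat // ltW.
pose e := trunc_log 2 (Num.truncn y).
have /andP[e_lo e_hi] := trunc_log_bounds (isT : (1 < 2)%N) t0.
have elo : (2 ^ e)%:R <= y by apply: le_trans ty1; rewrite ler_nat.
have ehi : y <= 2 * (2 ^ e)%:R.
  by apply/ltW/(lt_le_trans ty2); rewrite -natrM -expnS ler_nat; exact: e_hi.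
have ee0 : (e0 <= e)%N.
  by apply: trunc_log_max => //; rewrite truncn_ge_nat // (ltW y0).
have Leta (x p : R) : 0 < p -> 0 <= x -> x `^ p^-1 <= L -> x <= L `^ p.
  move=> p0 x0 hx; rewrite -[leLHS](@powRK _ p^-1) ?invrK ?invr_neq0 ?gt_eqF //.
  by apply: ge0_ler_powR; rewrite ?nnegrE ?powR_ge0 ?(ltW p0) ?(ltW L0).
have LD p q : L `^ (p + q) = L `^ p * L `^ q.
  by apply: powRD; rewrite (gt_eqF L0) implybT.
have [hi|hii] := @pdeg_dichotomy R n f e tf.
  have := he0 e d ee0 hi => hd; apply: le_trans hd.
  have hy : y `^ (c - 2 * h) <= 2 `^ c * (2 ^ e)%:R `^ (c - 2 * h).
    apply: (@le_trans _ _ ((2 * (2 ^ e)%:R) `^ (c - 2 * h))).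
      by apply: ge0_ler_powR; rewrite ?nnegrE ?(ltW y0) ?mulr_ge0.
    by rewrite powRM // ler_wpM2r ?powR_ge0 // ler_powR // ler1n.
  rewrite -(ler_pM2l (powR_gt0 c (ltr0n R 2))); apply: le_trans hy.
  rewrite mulrC; apply: (@le_trans _ _ (L `^ (c / (c + 1) - eta) * L `^ (eta / 2))).
    rewrite ler_wpM2l ?powR_ge0 //; apply: Leta => //; first exact: divr_gt0.
    exact: powR_ge0.
  by rewrite -LD -powRrM; apply: ler_powR.
have L2e : L <= y * (892 * d%:R).
  apply: (@le_trans _ _ ((2 ^ e * (446 * d.+1))%:R)).
    by rewrite -[leRHS]log2_exp expnM; apply: ler_log2; [exact: n0|exact: hii].
  rewrite natrM; apply: ler_pM; [by []|by []|exact: elo|].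
  by rewrite -natrM ler_nat; exact: leq_446_892.
have Ly : L = y * L `^ (c / (c + 1)).
  rewrite /y -LD (_ : _ + _ = 1) ?powRr1 ?(ltW L0) //.
  by field.
rewrite -(ler_pM2l (ltr0n R 892)).
have Lg : L `^ (c / (c + 1)) <= 892 * d%:R.
  by rewrite -(ler_pM2l y0) -Ly.
apply: le_trans Lg.
rewrite mulrC; apply: (@le_trans _ _ (L `^ (c / (c + 1) - eta) * L `^ eta)).
  by rewrite ler_wpM2l ?powR_ge0 //; apply: Leta.
by rewrite -LD subrK.
Qed.

End Asymptotics.

Theorem theorem1 (R : realType) (c : R) (hc : 0 < c)
  (hOR : exists eps : nat -> R,
     [/\ forall n, 0 <= eps n,
         eps n @[n --> \oo] --> 0 &
         \forall n \near \oo,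
           log2 (n%:R : R) `^ (c - eps n) <= (pdeg R (OR n))%:R]) :
  exists delta : nat -> R,
    [/\ forall n, 0 <= delta n,
        delta n @[n --> \oo] --> 0 &
        forall (n : nat) (f : boolfun n), truly_nvariate f ->
          log2 (n%:R : R) `^ (c / (c + 1) - delta n) <= (pdeg R f)%:R].
Proof.
case: hOR => eps [_ heps hOR]; set g := c / (c + 1).
have g0 : 0 <= g by rewrite divr_ge0 ?addr_ge0 ?(ltW hc).
(* Diagonalise over the losses [1 / (k + 1)]: if any [k <= n] has a valid bound at [n], then [s n]
   is the largest such [k]; otherwise [delta] takes the default [g + 1], which makes the exponent
   -1. *)
pose ok n k := `[< forall f : boolfun n, truly_nvariate f ->
  log2 (n%:R : R) `^ (g - k.+1%:R^-1) <= (pdeg R f)%:R >].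
pose s n := \max_(k < n.+1 | ok n k) (k : nat).
pose delta n : R := if ok n (s n) then (s n).+1%:R^-1 else g + 1.
have ok_s n k : (k <= n)%N -> ok n k -> ok n (s n) /\ (k <= s n)%N.
  move=> kn okk; have kn1 : (k < n.+1)%N by [].
  split; last by rewrite /s (bigD1 (Ordinal kn1)) //= leq_maxl.
  have [|j /= okj sj] := @eq_bigmax_cond _ (fun j : 'I_n.+1 => ok n j) (fun j => j : nat).
    by apply/card_gt0P; exists (Ordinal kn1).
  by rewrite /s sj.
exists delta; split.
- by move=> n; rewrite /delta; case: ifP => _; rewrite ?invr_ge0 ?addr_ge0.
- apply/cvgr0Pnorm_lt => e e0.
  have [k hk] := exists_nat_ge e^-1.
  have k0 : 0 < k.+1%:R^-1 :> R by rewrite invr_gt0.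
  have [N hN] := pdeg_lower hc k0 heps hOR.
  exists (maxn N k) => // n /=; rewrite geq_max => /andP[Nn kn].
  have [oks ks] : ok n (s n) /\ (k <= s n)%N.
    by apply: ok_s => //; apply/asboolP => f; apply: hN.
  rewrite /delta oks ger0_norm ?invr_ge0 //.
  rewrite invf_plt ?posrE //; apply: (le_lt_trans hk).
  by rewrite ltr_nat ltnS.
- move=> n f tf; rewrite /delta; case: ifP => [/asboolP|_]; first exact.
  rewrite (_ : g - (g + 1) = -1); last by ring.
  (* For [n <= 1] the logarithm is 0 and so is its power; for larger [n] it is at least 1, so its
     inverse is at most 1, while [pdeg] is positive. *)
  case: (leqP n 1) => [n1|n1].
    have -> : log2 (n%:R : R) = 0.
      by case: n n1 {f tf} => [|[|//]] _; rewrite /log2 ?ln1 ?mul0r // ln0 ?mul0r.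
    by rewrite powR0 // oppr_eq0 oner_eq0.
  apply: (@le_trans _ _ 1); last by rewrite ler1n pdeg_gt0 // ltnW.
  have L1 : 1 <= log2 (n%:R : R).
    by rewrite -[leLHS](@log2_exp R 1); apply: ler_log2.
  have L0 := lt_le_trans ltr01 L1.
  by rewrite powR_inv1 ?(ltW L0) // invf_le1.
Qed.
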